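(* Let $p,q$ be real numbers with $1 \leq p \leq q$, let $1\le d\le n$ be integers, and let $h:\{-1,1\}^{n} \to \mathbb{C}$ be a $d$-homogeneous polynomial. Then $$\|h\|_q \leq C_{p,q,d}\,\|h\|_p,$$ where $$C_{p,q,d} = \begin{cases} \exp\left\{\left(\frac{1}{p}-\frac{1}{q}\right)d\right\}, & \text{if } 1 \leq p \leq q \leq 2, \\ (q-1)^{\frac{q-p}{p(q-2)}\cdot\frac{d}{2}}, & \text{if } 1 \leq p \leq 2 < q \text{ and } \frac{1}{p}+\frac{1}{q} > 1,\\ (q-1)^{\frac{d}{2}}, & \text{if } 1 \leq p \leq 2 \leq q \text{ and } \frac{1}{p}+\frac{1}{q} \leq 1,\\ \left(\frac{q-1}{p-1}\right)^{\frac{d}{2}}, & \text{if } 2 < p \leq q. \end{cases}$$ Moreover, the constants in the third and fourth cases are asymptotically sharp as $d\to\infty$, in the sense defined in the context.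
   Context: A $d$-homogeneous polynomial on the discrete cube $\{-1,1\}^n$ (a Rademacher chaos of order $d$), with $n\ge d$, is a function of the form $h(x) = \sum_{1 \leq i_1<\ldots<i_d \leq n} a_{i_1,\ldots,i_d}\,x_{i_1}\cdots x_{i_d}$, $x=(x_1,\ldots,x_n)\in\{-1,1\}^n$, with complex coefficients $a_{i_1,\ldots,i_d}$. For $p>0$ and $f:\{-1,1\}^n\to\mathbb{C}$, $\|f\|_p = (\mathbb{E}|f|^p)^{1/p}$, where the expectation is with respect to the uniform probability measure on $\{-1,1\}^n$. For fixed $p,q$, a constant of the form $K^{d/2}$ with $K=K(p,q)>0$ in the inequality $\|h\|_q\le K^{d/2}\|h\|_p$ is called asymptotically sharp as $d\to\infty$ if it cannot be replaced by $C^{d/2}$ with $C<K$ as $d\to\infty$: that is, for every $0<C<K$ it is not true that, for all sufficiently large $d$, the inequality $\|h\|_q\le C^{d/2}\|h\|_p$ holds for all $n\ge d$ and all $d$-homogeneous polynomials $h:\{-1,1\}^n\to\mathbb{C}$. In the third case $K=q-1$, and in the fourth case $K=\frac{q-1}{p-1}$. *)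

(* Defs.v *)
From HB Require Import structures.
From mathcomp Require Import all_boot all_order all_algebra.
From mathcomp Require Import all_classical all_reals all_analysis.
From mathcomp Require Import complex.
Set Implicit Arguments.
Unset Strict Implicit.
Unset Printing Implicit Defensive.
Import Order.TTheory GRing.Theory Num.Theory.
Local Open Scope ring_scope.

(* A vertex x of {-1,1}^n is encoded by the booleans x i : the bit false stands
   for the coordinate 1 and true for -1, so that the i-th coordinate is
   (-1) ^+ x i. *)
Definition cube (n : nat) := {ffun 'I_n -> bool}.

Definition coord (R : realType) (n : nat) (x : cube n) (i : 'I_n) : R[i] :=
  (-1) ^+ x i.

Definition expectation (R : realType) (n : nat) (f : cube n -> R) : R :=
  (\sum_(x : cube n) f x) / #|{: cube n}|%:R.

Definition cube_norm (R : realType) (n : nat) (p : R) (f : cube n -> R[i]) : R :=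
  (expectation (fun x => (Normc.normc (f x)) `^ p)) `^ (p^-1).

(* The sum ranges over the strictly increasing d-tuples of indices. *)
Definition homogeneous (R : realType) (d n : nat) (h : cube n -> R[i]) : Prop :=
  exists a : d.-tuple 'I_n -> R[i], forall x : cube n,
    h x = \sum_(t : d.-tuple 'I_n | sorted ltn (map val t))
            a t * \prod_(k < d) coord R x (tnth t k).

(* The conditions of the first and third cases overlap only at p = q = 2, where
   both formulas give 1.  For 1 <= p <= q the last branch is reached exactly
   when 2 < p. *)
Definition chaos_const (R : realType) (p q : R) (d : nat) : R :=
  if [&& 1 <= p, p <= q & q <= 2] then
    expR ((p^-1 - q^-1) * d%:R)
  else if [&& 1 <= p, p <= 2, 2 < q & 1 < p^-1 + q^-1] then
    (q - 1) `^ ((q - p) / (p * (q - 2)) * (d%:R / 2))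
  else if [&& 1 <= p, p <= 2, 2 <= q & p^-1 + q^-1 <= 1] then
    (q - 1) `^ (d%:R / 2)
  else
    ((q - 1) / (p - 1)) `^ (d%:R / 2).

Definition asymptotically_sharp (R : realType) (p q K : R) : Prop :=
  forall C : R, 0 < C -> C < K ->
    ~ exists D : nat, forall d : nat, (D <= d)%N ->
        forall n : nat, (d <= n)%N ->
        forall h : cube n -> R[i], homogeneous d h ->
          cube_norm q h <= C `^ (d%:R / 2) * cube_norm p h.

(* Main.v *)
Require Import Defs.
From HB Require Import structures.
From mathcomp Require Import all_boot all_order all_algebra.
From mathcomp Require Import all_classical all_reals all_analysis.
From mathcomp Require Import complex ring lra.
Import Order.TTheory GRing.Theory Num.Theory.
Import numFieldNormedType.Exports.
Local Open Scope ring_scope.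
Set Implicit Arguments.
Unset Strict Implicit.
Unset Printing Implicit Defensive.

(* The upper bounds come from contractivity L^p -> L^q of the noise operators
   w_S |-> z^|S| w_S on the cube, which multiply a d-homogeneous h by z^d.
   Contractivity tensorizes by Minkowski's inequality, so it is a statement on
   two points.  For z = sqrt ((p - 1) / (q - 1)) (Bonami) it follows from the
   two-point logarithmic Sobolev and Stroock-Varopoulos inequalities by
   differentiating along the semigroup.  For conjugate p <= 2 <= q and
   z = i sqrt (p - 1) (Beckner) it follows from the real cases p -> 2 and 2 -> q
   applied to the real and imaginary parts.  Beckner's case gives the bound for
   1/p + 1/q <= 1; convexity of s |-> ln ||h||_(1/s) then gives the case
   p <= 2 < q, and letting q -> 2 bounds its slope at s = 1/2, hence at all
   s >= 1/2, which is the case q <= 2.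

   For sharpness, h is the elementary symmetric polynomial of degree d in
   n = M d variables.  Testing it against prod_i exp (t x_i) with
   t^2 = (q - 1) / M gives ||h||_q >= (q - 1 - eps)^(d/2) ||h||_2, where eps -> 0
   as d and then M tend to infinity; the norm ||h||_p is compared with ||h||_2
   by monotonicity (p <= 2) or by Bonami's bound (p > 2). *)

(** * Averages and norms over a finite type *)

(* Locked, since conversion between two norms would otherwise unfold real powers
   down to the exponential series. *)
HB.lock Definition avg (R : realType) (T : finType) (f : T -> R) : R :=
  (\sum_x f x) / #|{: T}|%:R.

HB.lock Definition nrm (R : realType) (T : finType) (p : R) (f : T -> R) : R :=
  (avg (fun x => f x `^ p)) `^ p^-1.

Section Averages.
Context {R : realType}.

Local Notation avgE := avg.unlock.
Local Notation nrmE := nrm.unlock.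

Section AvgTheory.
Variable T : finType.
Implicit Types (f g : T -> R) (c p q : R).

Lemma nrm_def p f : nrm p f = avg (fun x => f x `^ p) `^ p^-1.
Proof. by rewrite nrmE. Qed.

Lemma eq_avg f g : f =1 g -> avg f = avg g.
Proof. by move=> fg; rewrite !avgE (eq_bigr g). Qed.

Lemma eq_nrm p f g : f =1 g -> nrm p f = nrm p g.
Proof. by move=> fg; rewrite nrmE; congr (_ `^ _); apply: eq_avg => x; rewrite fg. Qed.

Lemma avgD f g : avg (fun x => f x + g x) = avg f + avg g.
Proof. by rewrite !avgE big_split mulrDl. Qed.

Lemma avgZ c f : avg (fun x => c * f x) = c * avg f.
Proof. by rewrite !avgE -big_distrr mulrA. Qed.

Lemma ler_avg f g : (forall x, f x <= g x) -> avg f <= avg g.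
Proof. by move=> fg; rewrite avgE ler_wpM2r ?invr_ge0// ler_sum. Qed.

Lemma avg_ge0 f : (forall x, 0 <= f x) -> 0 <= avg f.
Proof. by move=> f0; rewrite avgE divr_ge0// sumr_ge0. Qed.

Lemma avg_cst (x0 : T) c : avg (fun _ : T => c) = c.
Proof.
have T0 : #|{: T}|%:R != 0 :> R.
  by rewrite pnatr_eq0 -lt0n; apply/card_gt0P; exists x0.
by rewrite !avgE sumr_const -[c *+ _]mulr_natr mulfK.
Qed.

Lemma avg_eq0 (x0 : T) f : (forall x, 0 <= f x) -> avg f = 0 -> forall x, f x = 0.
Proof.
move=> f0 /eqP; rewrite !avgE mulf_eq0 invr_eq0 => /orP[|].
  by rewrite psumr_eq0// => /allP h x; apply/eqP/h; rewrite mem_index_enum.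
by rewrite pnatr_eq0 => /eqP T0 x; have := fintype0 x T0.
Qed.

Lemma powRK c p : 0 <= c -> p != 0 -> (c `^ p) `^ p^-1 = c.
Proof. by move=> c0 p0; rewrite -powRrM divff// powRr1. Qed.

Lemma powRVK c p : 0 <= c -> p != 0 -> (c `^ p^-1) `^ p = c.
Proof. by move=> c0 p0; rewrite -powRrM mulVf// powRr1. Qed.

Lemma powR_invr c p : 0 <= c -> c^-1 `^ p = (c `^ p)^-1.
Proof. by move=> c0; rewrite -powR_inv1// powRAC powR_inv1// powR_ge0. Qed.

Lemma nrm_ge0 p f : 0 <= nrm p f.
Proof. by rewrite nrmE powR_ge0. Qed.

Lemma nrm_powR p f : p != 0 -> nrm p f `^ p = avg (fun x => f x `^ p).
Proof. by move=> p0; rewrite nrmE powRVK// avg_ge0// => x; exact: powR_ge0. Qed.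

Lemma nrm_eq0 (x0 : T) p f : 0 < p -> nrm p f = 0 -> forall x, f x = 0.
Proof.
rewrite nrmE => p0 /powR_eq0_eq0 /(avg_eq0 x0) h x; apply: powR_eq0_eq0 (h _ x) => y.
exact: powR_ge0.
Qed.

Lemma ler_nrm p f g : 0 < p -> (forall x, 0 <= f x) ->
  (forall x, f x <= g x) -> nrm p f <= nrm p g.
Proof.
move=> p0 f0 fg; have g0 x : 0 <= g x := le_trans (f0 x) (fg x).
have h : forall x, f x `^ p <= g x `^ p.
  by move=> x; rewrite ge0_ler_powR ?nnegrE// ltW.
rewrite nrmE ge0_ler_powR ?nnegrE ?invr_ge0 ?(ltW p0)//.
- by apply: avg_ge0 => x; exact: powR_ge0.
- by apply: avg_ge0 => x; exact: powR_ge0.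
- exact: ler_avg.
Qed.

Lemma nrmZ p c f : 0 < p -> 0 <= c -> (forall x, 0 <= f x) ->
  nrm p (fun x => c * f x) = c * nrm p f.
Proof.
move=> p0 c0 f0; rewrite nrmE.
under eq_avg do rewrite powRM//.
by rewrite avgZ powRM ?powRK ?powR_ge0 ?gt_eqF// avg_ge0// => x; exact: powR_ge0.
Qed.

Lemma nrm_cst (x0 : T) p c : 0 < p -> 0 <= c -> nrm p (fun _ : T => c) = c.
Proof. by move=> p0 c0; rewrite nrmE (avg_cst x0) powRK// gt_eqF. Qed.

Lemma nrm0 p : 0 < p -> nrm p (fun _ : T => 0) = 0.
Proof.
move=> p0; rewrite nrmE avgE.
under eq_bigr do rewrite powR0 ?gt_eqF//.
by rewrite big1// mul0r powR0// invr_eq0 gt_eqF.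
Qed.

Lemma ge0_eq_powR p c : 0 < p -> 0 <= c -> (c == 0) = (c `^ p == 0).
Proof. by move=> p0 c0; rewrite powR_eq0 (gt_eqF p0) andbT. Qed.

(** Young's inequality is applied pointwise to f and g divided by their norms, and then averaged; a
    vanishing norm forces the function to vanish. *)
Lemma hoelder_avg p q f g : 0 < p -> 0 < q -> p^-1 + q^-1 = 1 ->
  (forall x, 0 <= f x) -> (forall x, 0 <= g x) ->
  avg (fun x => f x * g x) <= nrm p f * nrm q g.
Proof.
move=> p0 q0 pq f0 g0.
(* Averaging a constant requires a point of [T]; over the empty type the left-hand average is 0. *)
have [x0 _|T0] := pickP (fun _ : T => true); last first.
  rewrite !avgE big_pred0 ?mul0r ?mulr_ge0 ?nrm_ge0//.
have [A0|A0] := eqVneq (nrm p f) 0.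
  rewrite (eq_avg (g := fun=> 0)) ?(avg_cst x0) ?A0 ?mul0r// => x.
  by rewrite (nrm_eq0 x0 p0 A0) mul0r.
have [B0|B0] := eqVneq (nrm q g) 0.
  rewrite (eq_avg (g := fun=> 0)) ?(avg_cst x0) ?B0 ?mulr0// => x.
  by rewrite (nrm_eq0 x0 q0 B0) mulr0.
have A1 : 0 < nrm p f by rewrite lt_def A0 nrm_ge0.
have B1 : 0 < nrm q g by rewrite lt_def B0 nrm_ge0.
have {}h x : f x * g x <= (nrm p f * nrm q g) *
    ((p^-1 / nrm p f `^ p) * f x `^ p + (q^-1 / nrm q g `^ q) * g x `^ q).
  have -> : f x * g x = nrm p f * nrm q g * ((nrm p f)^-1 * f x * ((nrm q g)^-1 * g x)).
    by field; rewrite A0 B0.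
  rewrite ler_wpM2l ?mulr_ge0 ?nrm_ge0//.
  have := @conjugate_powR _ ((nrm p f)^-1 * f x) ((nrm q g)^-1 * g x) p q.
  rewrite !powRM ?invr_ge0 ?nrm_ge0//.
  rewrite !powR_invr ?nrm_ge0// => H.
  apply: le_trans (H _ _ p0 q0 pq) _; rewrite ?mulr_ge0 ?invr_ge0 ?powR_ge0 ?nrm_ge0//.
  by rewrite (mulrC p^-1) (mulrC q^-1) !(mulrAC _ _^-1 (_ `^ _)).
apply: le_trans (ler_avg h) _.
rewrite avgZ avgD !avgZ -!nrm_powR ?gt_eqF//.
by rewrite !divfK ?pq ?mulr1// -ge0_eq_powR ?nrm_ge0.
Qed.

(* With A, B the norms of f and g, f + g = (A + B) (a f/A + b g/B) where
   a = A/(A+B), b = B/(A+B), and u |-> u^p is convex. *)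
Lemma minkowski_avg p f g : 1 <= p ->
  (forall x, 0 <= f x) -> (forall x, 0 <= g x) ->
  nrm p (fun x => f x + g x) <= nrm p f + nrm p g.
Proof.
move=> p1 f0 g0; have p0 : 0 < p by apply: lt_le_trans p1.
have [x0 _|T0] := pickP (fun _ : T => true); last first.
  by rewrite nrmE avgE big_pred0// mul0r powR0 ?invr_eq0 ?gt_eqF// addr_ge0// powR_ge0.
have [A0|A0] := eqVneq (nrm p f) 0.
  rewrite A0 add0r (@eq_nrm _ _ g)// => x.
  by rewrite (nrm_eq0 x0 p0 A0) add0r.
have [B0|B0] := eqVneq (nrm p g) 0.
  rewrite B0 addr0 (@eq_nrm _ _ f)// => x.
  by rewrite (nrm_eq0 x0 p0 B0) addr0.
have A1 : 0 < nrm p f by rewrite lt_def A0 nrm_ge0.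
have B1 : 0 < nrm p g by rewrite lt_def B0 nrm_ge0.
set A := nrm p f in A0 A1 *; set B := nrm p g in B0 B1 *.
have S1 : 0 < A + B by rewrite addr_gt0.
have h x : (f x + g x) `^ p <= (A + B) `^ p *
   (A / (A + B) / A `^ p * f x `^ p + B / (A + B) / B `^ p * g x `^ p).
  have -> : f x + g x = (A + B) * (A / (A + B) * (A^-1 * f x) + B / (A + B) * (B^-1 * g x)).
    by field; rewrite A0 B0 gt_eqF.
  have fA : 0 <= A^-1 * f x by rewrite mulr_ge0// invr_ge0 ltW.
  have gB : 0 <= B^-1 * g x by rewrite mulr_ge0// invr_ge0 ltW.
  have a0 : 0 <= A / (A + B) by rewrite divr_ge0 ?ltW.
  have b0 : 0 <= B / (A + B) by rewrite divr_ge0 ?ltW.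
  rewrite powRM; [|exact: ltW|by rewrite addr_ge0// mulr_ge0].
  rewrite ler_wpM2l ?powR_ge0//.
  have a1 : A / (A + B) <= 1 by rewrite ler_pdivrMr// mul1r lerDl ltW.
  have := @convex_powR R p p1 (Itv01 a0 a1) (A^-1 * f x) (B^-1 * g x).
  rewrite !inE/= !in_itv/= !andbT => /(_ fA gB).
  rewrite convRE [X in X `^ _ <= _]convRE/= /unstable.onem.
  have -> : 1 - A / (A + B) = B / (A + B) by field; rewrite gt_eqF.
  move=> H; apply: le_trans H _.
  by rewrite !powRM ?invr_ge0 ?(ltW A1) ?(ltW B1)// !powR_invr ?(ltW A1) ?(ltW B1)// !mulrA.
rewrite -[leRHS](@powRK _ p) ?(ltW S1) ?gt_eqF//.
rewrite nrmE ge0_ler_powR ?nnegrE ?invr_ge0 ?(ltW p0) ?powR_ge0//.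
  by apply: avg_ge0 => x; exact: powR_ge0.
apply: le_trans (ler_avg h) _.
rewrite avgZ avgD !avgZ -!nrm_powR ?gt_eqF// -/A -/B.
rewrite !divfK -?ge0_eq_powR// ?(ltW A1) ?(ltW B1)//.
by rewrite -mulrDl divff ?mulr1// gt_eqF.
Qed.

Lemma nrm_powR_powR p s f : 0 < p -> 0 < s ->
  (forall x, 0 <= f x) -> nrm p f `^ s = nrm (p / s) (fun x => f x `^ s).
Proof.
move=> p0 s0 f0; rewrite !nrm_def -powRrM invf_div [s / p]mulrC.
congr (_ `^ _); apply: eq_avg => x.
by rewrite -powRrM mulrCA divff ?mulr1// gt_eqF.
Qed.

(** Hoelder's inequality with exponents 1/a and 1/(1 - a), applied to f^(p a) and f^(q (1 - a)). *)
Lemma lyapunov_avg p q (a : R) f : 0 < p -> 0 < q -> 0 < a < 1 ->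
  (forall x, 0 <= f x) ->
  avg (fun x => f x `^ (a * p + (1 - a) * q)) <=
  avg (fun x => f x `^ p) `^ a * avg (fun x => f x `^ q) `^ (1 - a).
Proof.
move=> p0 q0 /andP[a0 a1] f0; have b0 : 0 < 1 - a by rewrite subr_gt0.
have := @hoelder_avg a^-1 (1 - a)^-1 (fun x => f x `^ (p * a)) (fun x => f x `^ (q * (1 - a))).
rewrite !invr_gt0 !invrK subrKC => /(_ a0 b0 erefl) H.
have e x : f x `^ (a * p + (1 - a) * q) = f x `^ (p * a) * f x `^ (q * (1 - a)).
  rewrite (mulrC a) (mulrC (1 - a)) powRD//.
  by rewrite gt_eqF// addr_gt0// mulr_gt0.
rewrite (eq_avg e); apply: le_trans (H _ _) _ => [x|x|]; rewrite ?powR_ge0//.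
have powRKM (r c x : R) : 0 < c -> (x `^ (r * c)) `^ c^-1 = x `^ r.
  by move=> c0; rewrite powRrM powRK ?powR_ge0// gt_eqF.
have nrmKM (r c : R) : 0 < c ->
    nrm c^-1 (fun x => f x `^ (r * c)) = avg (fun x => f x `^ r) `^ c.
  move=> c0; rewrite nrm_def invrK; congr (_ `^ _).
  by apply: eq_avg => x; exact: powRKM.
by rewrite !nrmKM.
Qed.

(** Hoelder's inequality for f^p against the constant 1, with exponent q/p on f^p. It relies on the
    averages being normalized. *)
Lemma nrm_mono p q f : 0 < p -> p <= q -> (forall x, 0 <= f x) ->
  nrm p f <= nrm q f.
Proof.
move=> p0 pq f0; have q0 : 0 < q by apply: lt_le_trans pq.
have [x0 _|T0] := pickP (fun _ : T => true); last first.
  by rewrite nrmE avgE big_pred0// mul0r powR0 ?invr_eq0 ?gt_eqF// powR_ge0.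
have [->//|pNq] := eqVneq p q.
have {}pq : p < q by rewrite lt_neqAle pNq.
have s0 : 0 < q / p by rewrite divr_gt0.
have s1 : 1 < q / p by rewrite ltr_pdivlMr// mul1r.
have r0 : 0 < (1 - p / q)^-1.
  by rewrite invr_gt0 subr_gt0 ltr_pdivrMr// mul1r.
have := @hoelder_avg (q / p) ((1 - p / q)^-1) (fun x => f x `^ p) (fun _ => 1).
rewrite invrK invf_div subrKC => /(_ s0 r0 erefl) H.
rewrite -[leRHS](@powRK _ p) ?nrm_ge0 ?gt_eqF//.
rewrite nrmE ge0_ler_powR ?nnegrE ?invr_ge0 ?(ltW p0) ?powR_ge0//.
  by apply: avg_ge0 => x; exact: powR_ge0.
rewrite (@eq_avg (fun x => f x `^ p) (fun x => f x `^ p * 1)); last by move=> x; rewrite mulr1.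
apply: le_trans (H _ _) _ => [x|x|]; rewrite ?powR_ge0//.
rewrite (nrm_cst x0)// mulr1 nrmE invf_div -powRrM (mulrC q^-1).
rewrite (@eq_avg (fun x => (f x `^ p) `^ (q / p)) (fun x => f x `^ q))// => x.
by rewrite -powRrM mulrCA divff ?mulr1 ?gt_eqF.
Qed.

End AvgTheory.
End Averages.

(** * The real two-point inequality *)

Section Calculus.
Context {R : realType}.
Implicit Types (f g : R -> R) (x y : R).

(* A synonym of [is_derive] which typeclass resolution does not unfold. *)
Definition der f x (d : R) : Prop := is_derive x 1 f d.

Lemma der_eq f x (d d' : R) : der f x d -> d = d' -> der f x d'.
Proof. by move=> ? <-. Qed.

Lemma derD f g x (df dg : R) : der f x df -> der g x dg ->
  der (fun u => f u + g u) x (df + dg).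
Proof. by move=> ? ?; exact: is_deriveD. Qed.

Lemma derN f x (df : R) : der f x df -> der (fun u => - f u) x (- df).
Proof. by move=> ?; exact: is_deriveN. Qed.

Lemma derB f g x (df dg : R) : der f x df -> der g x dg ->
  der (fun u => f u - g u) x (df - dg).
Proof. by move=> ? ?; exact: is_deriveB. Qed.

Lemma derM f g x (df dg : R) : der f x df -> der g x dg ->
  der (fun u => f u * g u) x (df * g x + f x * dg).
Proof.
move=> hf hg; apply: (@is_derive_eq _ _ _ _ _ _ _ _ (is_deriveM hf hg)).
by rewrite /GRing.scale/= addrC mulrC.
Qed.

Lemma derC (c : R) x : der (fun=> c) x 0.
Proof. exact: is_derive_cst. Qed.

Lemma derI x : der (fun u => u) x 1.
Proof. exact: is_derive_id. Qed.

Lemma der_expR f x (df : R) : der f x df ->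
  der (fun u => expR (f u)) x (expR (f x) * df).
Proof. by move=> h; exact: (@is_derive1_comp _ expR f). Qed.

Lemma der_ln f x (df : R) : 0 < f x -> der f x df ->
  der (fun u => ln (f u)) x (df / f x).
Proof.
move=> fx h; rewrite mulrC; apply: (@is_derive1_comp _ (@ln R) f) => //.
exact: is_derive1_ln.
Qed.

Lemma derV f x (df : R) : f x != 0 -> der f x df ->
  der (fun u => (f u)^-1) x (- df / f x ^+ 2).
Proof.
move=> fx h; apply: (@is_derive_eq _ _ _ _ _ _ _ _ (is_deriveV fx h)).
by rewrite /GRing.scale/= mulrC mulNr mulrN.
Qed.

Lemma der_le f (df : R -> R) (a b : R) : a <= b ->
  (forall x, a <= x <= b -> der f x (df x)) ->
  (forall x, a <= x <= b -> 0 <= df x) -> f a <= f b.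
Proof.
move=> ab hd h0.
have [x||c] := @MVT_segment _ f df a b ab.
- by rewrite in_itv/= => /andP[/ltW ax /ltW xb]; apply: hd; rewrite ax.
- apply: derivable_within_continuous => x; rewrite in_itv/= => xab.
  by have := hd _ xab => -[].
rewrite in_itv/= => cab e.
by rewrite -subr_ge0 e mulr_ge0 ?h0// subr_ge0.
Qed.

(** * The two-point Stroock-Varopoulos inequality *)

Lemma sinh_ratio_le (k m y : R) : 0 <= k -> k <= m -> 0 <= y ->
  m * (expR (k * y) - expR (- (k * y))) <= k * (expR (m * y) - expR (- (m * y))).
Proof.
move=> k0 km y0.
(* G vanishes at 0, and its derivative is 2 k m (cosh (m u) - cosh (k u)), which is nonnegative
   since k <= m. *)
pose G (u : R) := k * (expR (m * u) - expR (- (m * u))) - m * (expR (k * u) - expR (- (k * u))).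
suff : G 0 <= G y by rewrite /G !mulr0 oppr0 subrr !mulr0 subr0 subr_ge0.
have derMl (c u : R) : der (fun v => c * v) u c.
  apply: der_eq; first by apply: derM; [exact: derC|exact: derI].
  by rewrite mul0r add0r mulr1.
apply: (@der_le G (fun u => k * m * ((expR (m * u) + expR (- (m * u)))
   - (expR (k * u) + expR (- (k * u)))))) => [//|u /andP[u0 uy]|u /andP[u0 uy]].
  apply: der_eq.
    apply: derB; (apply: derM; first exact: derC); apply: derB; apply: der_expR.
    - exact: derMl.
    - by apply: derN; exact: derMl.
    - exact: derMl.
    - by apply: derN; exact: derMl.
  rewrite /=; ring.
have m0 : 0 <= m by apply: le_trans km.
rewrite mulr_ge0 ?(mulr_ge0 k0)//.
(* With X = exp (m u) and Y = exp (k u), X + 1/X - Y - 1/Y = (X - Y) (1 - 1/(X Y)). *)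
have -> : expR (m * u) + expR (- (m * u)) - (expR (k * u) + expR (- (k * u))) =
   (expR (m * u) - expR (k * u)) * (1 - expR (- (m * u + k * u))).
  rewrite (expRN (m * u + _)) expRD !expRN; field.
  by rewrite !gt_eqF ?expR_gt0.
rewrite mulr_ge0// subr_ge0.
  by rewrite ler_expR ler_wpM2r.
by rewrite -expR0 ler_expR oppr_le0 addr_ge0// mulr_ge0// (le_trans k0).
Qed.

(* With m = s/2 and k = m - 1, s - 1 = m^2 - k^2 and
   sinh y sinh ((s-1) y) = sinh^2 (m y) - sinh^2 (k y). *)
Lemma stroock_varopoulos (a b s : R) : 0 < b -> b <= a -> 1 < s ->
  (expR (s / 2 * ln a) - expR (s / 2 * ln b)) ^+ 2 <=
  s ^+ 2 / (4 * (s - 1)) *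
    ((a - b) * (expR (s * ln a) / a - expR (s * ln b) / b)).
Proof.
move=> b0 ba s1; have a0 : 0 < a by apply: lt_le_trans ba.
(* Factoring out the geometric mean exp c leaves the symmetric pair exp y, exp (- y). *)
pose c := (ln a + ln b) / 2; pose y := (ln a - ln b) / 2.
have y0 : 0 <= y by rewrite /y divr_ge0// subr_ge0 ler_ln.
have la : ln a = c + y by rewrite /c /y; field.
have lb : ln b = c - y by rewrite /c /y; field.
have ea : a = expR (c + y) by rewrite -la lnK// posrE.
have eb : b = expR (c - y) by rewrite -lb lnK// posrE.
pose m := s / 2; pose k := m - 1.
pose P := expR (m * y); pose Q := expR (k * y); pose C := expR (m * c).
pose D := expR c.
have [P0 Q0 C0 D0] : [/\ P != 0, Q != 0, C != 0 & D != 0] by rewrite !gt_eqF ?expR_gt0.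
(* Here m - k = 1 is used; every power in the claim becomes a monomial in P, Q, C, D, so that
   [field] applies. *)
have ey : expR y = P / Q.
  by rewrite /P /Q -expRB; congr expR; rewrite /k; ring.
have E1 : expR (s / 2 * ln a) = C * P by rewrite la /C /P -expRD; congr expR; rewrite /m; ring.
have E2 : expR (s / 2 * ln b) = C / P by rewrite lb /C /P -expRB; congr expR; rewrite /m; ring.
have E3 : expR (s * ln a) = (C * P) ^+ 2 by rewrite -E1 -expRM_natl; congr expR; field.
have E4 : expR (s * ln b) = (C / P) ^+ 2 by rewrite -E2 -expRM_natl; congr expR; field.
have E5 : a = D * (P / Q) by rewrite ea expRD ey.
have E6 : b = D * (Q / P) by rewrite eb expRB ey invf_div.
rewrite E1 E2 E3 E4 {}E5 {}E6.
have -> : (D * (P / Q) - D * (Q / P)) *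
  ((C * P) ^+ 2 / (D * (P / Q)) - (C / P) ^+ 2 / (D * (Q / P))) =
  C ^+ 2 * ((P - P^-1) ^+ 2 - (Q - Q^-1) ^+ 2).
  by field; rewrite P0 Q0 D0.
have -> : (C * P - C / P) ^+ 2 = C ^+ 2 * (P - P^-1) ^+ 2 by ring.
rewrite [leRHS]mulrCA ler_wpM2l ?sqr_ge0//.
have -> : s = 2 * m by rewrite /m; field.
have h : 0 < m ^+ 2 - k ^+ 2 by rewrite /k /m; lra.
have -> : (2 * m) ^+ 2 / (4 * (2 * m - 1)) = m ^+ 2 / (m ^+ 2 - k ^+ 2).
  by rewrite /k; field; rewrite -/k gt_eqF.
rewrite mulrAC ler_pdivlMr// mulrBr mulrBr.
suff : m ^+ 2 * (Q - Q^-1) ^+ 2 <= k ^+ 2 * (P - P^-1) ^+ 2 by lra.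
rewrite -!exprMn.
have m0 : 0 <= m by rewrite /m; lra.
have HP : 0 <= P - P^-1.
  by rewrite /P -expRN subr_ge0 ler_expR; have := mulr_ge0 m0 y0; lra.
(* For s < 2 the number k is negative; since m > 1/2, |k| <= m still holds, and the sinh comparison
   is applied to |k|. *)
have Hk : `|k| <= m by rewrite ler_norml /k /m; lra.
have := sinh_ratio_le (normr_ge0 k) Hk y0.
rewrite !expRN -/P => H.
rewrite -[leLHS]real_normK ?num_real// -[leRHS]real_normK ?num_real// ler_sqr ?nnegrE//.
rewrite (normrM m) (normrM k) (ger0_norm HP) (ger0_norm m0).
apply: le_trans _ H; rewrite ler_wpM2l// /Q.
have [k0|k0] := leP 0 k.
  by rewrite (ger0_norm k0) ger0_norm// -expRN subr_ge0 ler_expR; have := mulr_ge0 k0 y0; lra.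
rewrite (ltr0_norm k0) mulNr expRN invrK distrC ger0_norm// -expRN subr_ge0 ler_expR.
by have := mulr_le0_ge0 (ltW k0) y0; lra.
Qed.

(** * The two-point logarithmic Sobolev inequality *)

Lemma logsob_aux x : 0 <= x -> x < 1 ->
  (1 + x) ^+ 2 * ln (1 + x) + (1 - x) ^+ 2 * ln (1 - x)
    - (1 + x ^+ 2) * ln (1 + x ^+ 2) <= 2 * x ^+ 2.
Proof.
move=> x0 x1.
have pos (u : R) : 0 <= u <= x -> [/\ 0 < 1 + u, 0 < 1 - u & 0 < 1 + u * u].
  by move=> /andP[u0 ux]; split; nra.
(* F1 is the derivative of the defect F2 defined below. Both vanish at 0, and F1' >= 0 because ln (1
   + v) + ln (1 - v) <= 0. *)
pose F1 (u : R) := 4 * u - (2 * ((1 + u) * ln (1 + u)) - 2 * ((1 - u) * ln (1 - u)) -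
   2 * (u * ln (1 + u * u))).
have derD1 (u : R) : der (fun v => 1 + v) u 1.
  by apply: der_eq; [apply: derD; [exact: derC|exact: derI]|rewrite add0r].
have derB1 (u : R) : der (fun v => 1 - v) u (- 1).
  by apply: der_eq; [apply: derB; [exact: derC|exact: derI]|rewrite sub0r].
have der_sqr (u : R) : der (fun v => v * v) u (2 * u).
  by apply: der_eq; [apply: derM; exact: derI|rewrite /= mul1r mulr1 -mulr2n mulr_natl].
have derS1 (u : R) : der (fun v => 1 + v * v) u (2 * u).
  by apply: der_eq; [apply: derD; [exact: derC|exact: der_sqr]|rewrite add0r].
have F1_ge0 (u : R) : 0 <= u <= x -> 0 <= F1 u.
  move=> /andP[u0 ux].
  suff : F1 0 <= F1 u by rewrite {1}/F1 !mul0r !addr0 subr0 ln1 !mulr0 !subr0.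
  apply: (@der_le F1 (fun v => 2 * ln (1 + v * v) + 4 * (v * v) / (1 + v * v)
     - 2 * (ln (1 + v) + ln (1 - v)))) => [//|v /andP[v0 vu]|v /andP[v0 vu]].
    have [p1 p2 p3] : [/\ 0 < 1 + v, 0 < 1 - v & 0 < 1 + v * v].
      by apply: pos; rewrite v0 (le_trans vu).
    apply: der_eq.
      apply: derB; first by apply: derM; [exact: derC|exact: derI].
      apply: derB.
        apply: derB; (apply: derM; first exact: derC).
          by apply: derM; [exact: derD1|apply: der_ln].
        by apply: derM; [exact: derB1|apply: der_ln].
      apply: derM; first exact: derC.
      by apply: derM; [exact: derI|apply: der_ln].
    by rewrite /=; field; rewrite !gt_eqF.
  have [p1 p2 p3] : [/\ 0 < 1 + v, 0 < 1 - v & 0 < 1 + v * v].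
    by apply: pos; rewrite v0 (le_trans vu).
  have l1 : ln (1 + v) <= v by rewrite le_ln1Dx//; lra.
  have l2 : ln (1 - v) <= - v by rewrite le_ln1Dx//; lra.
  have l3 : 0 <= ln (1 + v * v) by rewrite ln_ge0// lerDl mulr_ge0.
  have l4 : 0 <= 4 * (v * v) / (1 + v * v) by rewrite divr_ge0 ?mulr_ge0 ?(ltW p3).
  lra.
pose F2 (u : R) := 2 * (u * u) - ((1 + u) * (1 + u) * ln (1 + u) + (1 - u) * (1 - u) * ln (1 - u)
  - (1 + u * u) * ln (1 + u * u)).
suff : F2 0 <= F2 x.
  rewrite /F2 !mul0r !addr0 subr0 ln1 !mulr0 addr0 !subr0.
  by rewrite !expr2; lra.
apply: (@der_le F2 F1) => [//|v /andP[v0 vu]|v /andP[v0 vu]].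
  have [p1 p2 p3] : [/\ 0 < 1 + v, 0 < 1 - v & 0 < 1 + v * v].
    by apply: pos; rewrite v0.
  apply: der_eq.
    apply: derB; first by apply: derM; [exact: derC|exact: der_sqr].
    apply: derB; first apply: derD.
    + by apply: derM; [apply: derM; exact: derD1|apply: der_ln].
    + by apply: derM; [apply: derM; exact: derB1|apply: der_ln].
    + by apply: derM; [exact: derS1|apply: der_ln].
  by rewrite /F1 /=; field; rewrite !gt_eqF.
by apply: F1_ge0; rewrite v0.
Qed.

(** Both sides are homogeneous of degree 2: scaling by al multiplies them by al^2, the terms in ln
    al cancelling. This leaves the case of 1 + x and 1 - x. *)
Lemma logsob (A B : R) : 0 < B -> B <= A ->
  (A ^+ 2 * ln (A ^+ 2) + B ^+ 2 * ln (B ^+ 2)) / 2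
    - (A ^+ 2 + B ^+ 2) / 2 * ln ((A ^+ 2 + B ^+ 2) / 2) <= (A - B) ^+ 2 / 2.
Proof.
move=> B0 BA; have A0 : 0 < A by apply: lt_le_trans BA.
pose al := (A + B) / 2; pose x := (A - B) / (A + B).
have AB0 : A + B != 0 by rewrite gt_eqF// addr_gt0.
have al0 : 0 < al by rewrite divr_gt0// addr_gt0.
have x0 : 0 <= x by rewrite divr_ge0 ?subr_ge0// ltW// addr_gt0.
have x1 : x < 1 by rewrite ltr_pdivrMr ?addr_gt0//; lra.
have eA : A = al * (1 + x) by rewrite /al /x; field.
have eB : B = al * (1 - x) by rewrite /al /x; field.
have em : (A ^+ 2 + B ^+ 2) / 2 = al ^+ 2 * (1 + x ^+ 2) by rewrite /al /x; field.
have -> : (A - B) ^+ 2 / 2 = al ^+ 2 * (2 * x ^+ 2) by rewrite /al /x; field.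
have p1 : 0 < 1 + x by lra.
have p2 : 0 < 1 - x by lra.
have p3 : 0 < 1 + x ^+ 2 by rewrite ltr_wpDr// sqr_ge0.
have lA : ln A = ln al + ln (1 + x) by rewrite eA lnM.
have lB : ln B = ln al + ln (1 - x) by rewrite eB lnM.
have A2 : A ^+ 2 = al ^+ 2 * (1 + x) ^+ 2 by rewrite eA exprMn.
have B2 : B ^+ 2 = al ^+ 2 * (1 - x) ^+ 2 by rewrite eB exprMn.
rewrite em !lnXn// lnM ?posrE ?exprn_gt0// lnXn// lA lB A2 B2.
have := logsob_aux x0 x1.
rewrite -(ler_pM2l (exprn_gt0 2 al0)); apply: le_trans.
rewrite le_eqVlt; apply/orP; left; apply/eqP.
move: (ln al) (ln (1 + x)) (ln (1 - x)) (ln (1 + x ^+ 2)) => la l1 l2 l3.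
by clearbody al x; field.
Qed.

(** * Monotonicity of norms along the semigroup *)

Definition power_mean (s a b : R) := (expR (s * ln a) + expR (s * ln b)) / 2.

(** The logarithmic Sobolev inequality at A = a^(s/2), B = b^(s/2), whose right side (A - B)^2 / 2
    is then bounded by Stroock-Varopoulos. *)
Lemma entropy_le (a b s : R) : 0 < b -> b <= a -> 1 < s ->
  (expR (s * ln a) * (s * ln a) + expR (s * ln b) * (s * ln b)) / 2
    - power_mean s a b * ln (power_mean s a b) <=
  s ^+ 2 / (8 * (s - 1)) *
    ((a - b) * (expR (s * ln a) / a - expR (s * ln b) / b)).
Proof.
move=> b0 ba s1; have a0 : 0 < a by apply: lt_le_trans ba.
have E c : expR (s * ln c) = expR (s / 2 * ln c) ^+ 2.
  by rewrite -expRM_natl; congr expR; field.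
have := stroock_varopoulos b0 ba s1.
have h : expR (s / 2 * ln b) <= expR (s / 2 * ln a).
  by rewrite ler_expR ler_wpM2l ?ler_ln//; lra.
have := logsob (expR_gt0 _) h.
rewrite -!E -/(power_mean s a b) !expRK => H1 H2.
apply: le_trans H1 _; rewrite ler_pdivrMr//; apply: le_trans H2 _.
rewrite le_eqVlt; apply/orP; left; apply/eqP.
move: (_ * (_ / a - _ / b)) => X.
by field; rewrite gt_eqF//; lra.
Qed.

(** The exponent s(t) = 1 + (p - 1) exp (2 t) grows while the noise shrinks y to y exp (- t). The
    logarithm of the s(t)-norm is differentiated in t, and [entropy_le] gives the sign of the
    derivative. *)
Lemma hyper_mono (p y T : R) : 1 < p -> 0 <= y -> y < 1 -> 0 <= T ->
  ln (power_mean (1 + (p - 1) * expR (2 * T)) (1 + y * expR (- T)) (1 - y * expR (- T)))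
    / (1 + (p - 1) * expR (2 * T)) <= ln (power_mean p (1 + y) (1 - y)) / p.
Proof.
move=> p1 y0 y1 T0.
pose s t := 1 + (p - 1) * expR (2 * t); pose x t := y * expR (- t).
have x01 t : 0 <= t -> 0 <= x t < 1.
  move=> t0; rewrite /x mulr_ge0 ?expR_ge0//=.
  by rewrite (le_lt_trans _ y1)// ler_piMr// -expR0 ler_expR oppr_le0.
have s1 t : 1 < s t by rewrite /s ltrDl mulr_gt0 ?expR_gt0// subr_gt0.
pose M t := power_mean (s t) (1 + x t) (1 - x t).
(* The minus sign makes F nondecreasing, the form that [der_le] produces. *)
pose F t := - (ln (M t) * (s t)^-1).
suff : F 0 <= F T.
  by rewrite lerN2 /M /s /x mulr0 oppr0 expR0 !mulr1 subrKC.
have derx t : der x t (- x t).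
  apply: der_eq.
    apply: derM; first exact: derC.
    by apply: der_expR; apply: derN; exact: derI.
  by rewrite /x /= mul0r add0r mulrN1 mulrN.
have ders t : der s t (2 * (s t - 1)).
  apply: der_eq.
    apply: derD; first exact: derC.
    apply: derM; first exact: derC.
    by apply: der_expR; apply: derM; [exact: derC|exact: derI].
  by rewrite /s /=; ring.
have dera t : der (fun u => 1 + x u) t (- x t).
  by apply: der_eq; [apply: derD; [exact: derC|exact: derx]|rewrite add0r].
have derb t : der (fun u => 1 - x u) t (x t).
  by apply: der_eq; [apply: derB; [exact: derC|exact: derx]|rewrite opprK add0r].
have M0 t : 0 < M t by rewrite divr_gt0// addr_gt0 ?expR_gt0.
pose a t := 1 + x t; pose b t := 1 - x t.
pose P t := expR (s t * ln (a t)); pose Q t := expR (s t * ln (b t)).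
(* The derivative of M, computed from s' = 2 (s - 1) and x' = - x. *)
pose M' t := (P t * (2 * (s t - 1) * ln (a t) - s t * x t / a t)
   + Q t * (2 * (s t - 1) * ln (b t) + s t * x t / b t)) / 2.
have derM' t : 0 <= t -> der M t (M' t).
  move=> t0; have /andP[x0 x1] := x01 t t0.
  apply: der_eq.
    apply: derM; last exact: derC.
    by apply: derD; apply: der_expR; (apply: derM; first exact: ders);
       apply: der_ln; [|exact: dera| |exact: derb]; lra.
  rewrite /M' /P /Q /a /b /= mulr0 addr0; congr (_ / _).
  by congr (_ * _ + _ * _); ring.
apply: (@der_le F (fun t => (2 * (s t - 1) * ln (M t) - s t * (M' t / M t)) / s t ^+ 2))
    => [//|t /andP[t0 tT]|t /andP[t0 tT]].
  have sN : s t != 0 by rewrite gt_eqF// (lt_trans _ (s1 t)).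
  apply: der_eq.
    apply: derN; apply: derM.
      by apply: der_ln; [exact: M0|exact: derM'].
    by apply: derV; [exact: sN|exact: ders].
  rewrite /=.
  move: (M' t) (ln (M t)) (s t) sN (M t) (M0 t) => m' lm st sN m /gt_eqF m0.
  by field; rewrite sN m0.
rewrite divr_ge0 ?sqr_ge0//.
have /andP[x0 x1] := x01 t t0.
have b0 : 0 < b t by rewrite /b; lra.
have ba : b t <= a t by rewrite /b /a; lra.
have a0 : 0 < a t by apply: lt_le_trans ba.
have := entropy_le b0 ba (s1 t); rewrite -/(P t) -/(Q t) -/(M t).
have -> : a t - b t = 2 * x t by rewrite /a /b; ring.
have st0 : 0 < s t - 1 by rewrite subr_gt0.
move=> H.
(* Up to the positive factor 2 (s - 1) / M, the numerator of F' is the right side minus the left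
   side of [entropy_le]. *)
have -> : 2 * (s t - 1) * ln (M t) - s t * (M' t / M t) =
    (2 * (s t - 1) * (s t ^+ 2 / (8 * (s t - 1)) * (2 * x t * (P t / a t - Q t / b t))
     - ((P t * (s t * ln (a t)) + Q t * (s t * ln (b t))) / 2 - M t * ln (M t)))) / M t.
  rewrite /M'.
  move: (ln (a t)) (ln (b t)) (ln (M t)) (M t) (M0 t) (a t) a0 (b t) b0 (P t) (Q t) (s t) st0.
  move=> la lb lm m /gt_eqF m0 a' /gt_eqF a0 b' /gt_eqF b0 P' Q' s' /gt_eqF s0.
  by field; rewrite m0 a0 b0 s0.
by rewrite divr_ge0 ?(ltW (M0 t))// mulr_ge0 ?subr_ge0// mulr_ge0// ltW.
Qed.

(** * The two-point noise operator with real parameter *)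

Definition noise (r : R) (f : bool -> R) (b : bool) : R :=
  ((1 + r) * f b + (1 - r) * f (~~ b)) / 2.

Lemma avg_bool (f : bool -> R) : avg f = (f true + f false) / 2.
Proof. by rewrite avg.unlock card_bool big_bool. Qed.

Lemma nrm_bool_gt0 (p : R) (f : bool -> R) : (forall b, 0 < f b) ->
  nrm p f = expR (ln (power_mean p (f true) (f false)) / p).
Proof.
move=> f0; rewrite nrm.unlock avg_bool /powR !gt_eqF//.
  by rewrite mulrC.
by rewrite divr_gt0// addr_gt0 ?expR_gt0.
Qed.

Lemma nrm_bool_neg (p : R) (f : bool -> R) : nrm p (fun b => f (~~ b)) = nrm p f.
Proof. by rewrite nrm.unlock !avg_bool addrC. Qed.

(** By symmetry and homogeneity f takes the values c (1 + y) and c (1 - y) with 0 <= y < 1; the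
    noise replaces y by y r, which is [hyper_mono] at exp (- T) = r. *)
Lemma two_point_pos (p q r : R) (f : bool -> R) : 1 < p -> p <= q -> 0 < r ->
  r ^+ 2 = (p - 1) / (q - 1) -> (forall b, 0 < f b) ->
  nrm q (noise r f) <= nrm p f.
Proof.
move=> p1 pq r0 er; have q1 : 1 < q by apply: lt_le_trans pq.
wlog f12 : f / f false <= f true.
  move=> H f0; have [|/ltW h] := leP (f false) (f true); first by move=> h; apply: H.
  rewrite -nrm_bool_neg -(nrm_bool_neg p); apply: (H (fun b => f (~~ b))) => //.
move=> f0.
have r1 : r <= 1.
  rewrite -(@expr_le1 _ 2)// ?(ltW r0)// er ler_pdivrMr ?subr_gt0// mul1r; lra.
pose c := (f true + f false) / 2; pose y := (f true - f false) / (f true + f false).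
have c0 : 0 < c by rewrite divr_gt0// addr_gt0.
have sN : f true + f false != 0 by rewrite gt_eqF// addr_gt0.
have y0 : 0 <= y by rewrite divr_ge0 ?subr_ge0// ltW// addr_gt0.
have y1 : y < 1 by rewrite ltr_pdivrMr ?addr_gt0// mul1r; have := f0 false; lra.
have ry0 : 0 <= y * r < 1.
  by rewrite mulr_ge0 ?(ltW r0)//= (le_lt_trans _ y1)// ler_piMr.
pose g (u : R) (b : bool) := if b then 1 + u else 1 - u.
have ef b : f b = c * g y b by case: b; rewrite /g /c /y; field.
have en b : noise r f b = c * g (y * r) b.
  by rewrite /noise !ef; case: b; rewrite /= /g; field.
have g0 (u : R) b : 0 <= u < 1 -> 0 < g u b.
  by move=> /andP[u0 u1]; case: b; rewrite /g; lra.
rewrite (eq_nrm q en) (eq_nrm p ef) !nrmZ ?(ltW c0)//; last 4 first.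
- by apply: lt_trans p1.
- by move=> b; rewrite ltW// g0// y0.
- by apply: lt_trans q1.
- by move=> b; rewrite ltW// g0.
rewrite ler_pM2l// !nrm_bool_gt0 => [|b|b]; [|by rewrite g0 ?y0|by rewrite g0].
rewrite ler_expR /g.
(* For T = - ln r the final exponent is 1 + (p - 1) / r^2 = q. *)
have T0 : 0 <= - ln r by rewrite oppr_ge0 ln_le0.
have := hyper_mono p1 y0 y1 T0.
rewrite opprK lnK ?posrE//.
suff -> : 1 + (p - 1) * expR (2 * - ln r) = q by [].
rewrite mulrN expRN expRM_natl lnK ?posrE// er; field.
by rewrite !gt_eqF ?subr_gt0.
Qed.

Lemma noise_ge0 (r : R) (f : bool -> R) b : 0 <= r <= 1 -> (forall b, 0 <= f b) ->
  0 <= noise r f b.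
Proof.
move=> /andP[r0 r1] f0; rewrite divr_ge0// addr_ge0// mulr_ge0 ?subr_ge0//.
by rewrite addr_ge0.
Qed.

(** The positive case is applied to f + e. Noise fixes constants, and Minkowski's inequality bounds
    the norm of f + e by that of f plus e; then e tends to 0. *)
Lemma two_point (p q r : R) (f : bool -> R) : 1 < p -> p <= q -> 0 < r ->
  r ^+ 2 = (p - 1) / (q - 1) -> (forall b, 0 <= f b) ->
  nrm q (noise r f) <= nrm p f.
Proof.
move=> p1 pq r0 er f0; have q1 : 1 < q by apply: lt_le_trans pq.
have p0 : 0 < p by apply: lt_trans p1.
have r1 : r <= 1.
  rewrite -(@expr_le1 _ 2)// ?(ltW r0)// er ler_pdivrMr ?subr_gt0// mul1r; lra.
apply/ler_addgt0Pr => e e0.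
have fe b : 0 < f b + e by rewrite ltr_wpDl.
apply: le_trans (_ : nrm q (noise r (fun b => f b + e)) <= _).
  apply: ler_nrm => [|b|b]; first exact: lt_trans q1.
    by apply: noise_ge0 => //; rewrite (ltW r0).
  have -> : noise r (fun b => f b + e) b = noise r f b + e by rewrite /noise; field.
  by rewrite lerDl ltW.
apply: le_trans (two_point_pos p1 pq r0 er fe) _.
apply: le_trans (@minkowski_avg _ _ p f (fun=> e) (ltW p1) f0 (fun=> ltW e0)) _.
by rewrite (nrm_cst true) ?(ltW e0).
Qed.

End Calculus.

(** * The complex two-point inequalities *)

Section ComplexTwoPoint.
Context {R : realType}.
Local Notation normc := (@Normc.normc R).

Lemma normc_ge0 (z : R[i]) : 0 <= normc z.
Proof. by case: z => a b; exact: sqrtr_ge0. Qed.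

Lemma normc_real (c : R) : normc c%:C%C = `|c|.
Proof. by rewrite /= expr0n addr0 sqrtr_sqr. Qed.

Lemma nrm_sqr (T : finType) (p : R) (f : T -> R) : 0 < p -> (forall x, 0 <= f x) ->
  nrm p f ^+ 2 = nrm (p / 2) (fun x => f x ^+ 2).
Proof.
move=> p0 f0; rewrite -powR_mulrn ?nrm_ge0// nrm_powR_powR//.
by apply: eq_nrm => x; rewrite powR_mulrn.
Qed.

(* Minkowski's inequality with exponent 1/s for the average of the vectors
   (u b ^ s, c ^ s) of R^2. *)
Lemma rev_minkowski_bool (s c : R) (u : bool -> R) : 0 < s -> s <= 1 ->
  0 <= c -> (forall b, 0 <= u b) -> nrm s u + c <= nrm s (fun b => u b + c).
Proof.
move=> s0 s1 c0 u0.
have sN : s != 0 by rewrite gt_eqF.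
pose V b (j : bool) := 2^-1 * (if j then u b `^ s else c `^ s).
have V0 b j : 0 <= V b j by rewrite mulr_ge0 ?invr_ge0//; case: j; exact: powR_ge0.
have s'1 : 1 <= s^-1 by rewrite invf_ge1.
have s'0 : 0 < s^-1 by rewrite invr_gt0.
have nV b : nrm s^-1 (V b) = 2^-1 * ((u b + c) / 2) `^ s.
  rewrite nrmZ ?invr_ge0//; last by case; exact: powR_ge0.
  by rewrite nrm.unlock avg_bool invrK !powRK.
have nS : nrm s^-1 (fun j => V true j + V false j) = ((nrm s u + c) / 2) `^ s.
  rewrite [in LHS]nrm.unlock avg_bool invrK /V; congr (((_ + _) / 2) `^ s).
    by rewrite nrm.unlock avg_bool -mulrDr mulrC.
  by rewrite -mulrDr -mulr2n -[c `^ s *+ 2]mulr_natl mulKf// powRK.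
have := minkowski_avg s'1 (V0 true) (V0 false).
rewrite nS !nV -mulrDr !powRM ?invr_ge0 ?addr_ge0 ?nrm_ge0//.
rewrite -mulrDl mulrA ler_pM2r ?powR_gt0 ?invr_gt0// => H.
rewrite -[leLHS](@powRK _ _ s)// ?addr_ge0 ?nrm_ge0//.
rewrite [in leRHS]nrm.unlock ge0_ler_powR ?nnegrE ?invr_ge0 ?(ltW s0) ?powR_ge0//.
  by apply: avg_ge0 => x; exact: powR_ge0.
by rewrite avg_bool mulrC.
Qed.

Definition sgb (b : bool) : R := if b then -1 else 1.

(** The weights (1 + r)/2 and (1 - r)/2 are nonnegative, so the modulus of the noise is at most the
    noise of the modulus; this extends [two_point] to functions that change sign. *)
Lemma two_point_sgb (p q r x : R) : 1 < p -> p <= q -> 0 < r ->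
  r ^+ 2 = (p - 1) / (q - 1) ->
  nrm q (fun b => `|1 + sgb b * (r * x)|) <= nrm p (fun b => `|1 + sgb b * x|).
Proof.
move=> p1 pq r0 er; have q1 : 1 < q by apply: lt_le_trans pq.
have r1 : r <= 1.
  rewrite -(@expr_le1 _ 2)// ?(ltW r0)// er ler_pdivrMr ?subr_gt0// mul1r; lra.
apply: le_trans (two_point p1 pq r0 er (fun b => normr_ge0 (1 + sgb b * x))).
apply: ler_nrm => [|b|b]; [exact: lt_trans q1|exact: normr_ge0|].
have r1' : 0 <= 1 - r by rewrite subr_ge0.
have r2' : 0 <= 1 + r by rewrite addr_ge0 ?(ltW r0).
rewrite /noise ler_pdivlMr// -{1}(ger0_norm r1') -{1}(ger0_norm r2').
rewrite -(@ger0_norm _ 2)// -!normrM; apply: le_trans (ler_normD _ _).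
rewrite le_eqVlt; apply/orP; left; apply/eqP; congr `|_|.
by case: b; rewrite /sgb /=; ring.
Qed.

Lemma nrm2_sgb (x : R) : nrm 2 (fun b => `|1 + sgb b * x|) ^+ 2 = 1 + x ^+ 2.
Proof.
rewrite -powR_mulrn ?nrm_ge0// nrm_powR// avg_bool !powR_mulrn//.
by rewrite !real_normK ?num_real// /sgb; field.
Qed.

(** The right side is the norm of 1 + sgb b (x + i y), the left side that of its image under z = i
    w. Minkowski's inequality in L^(q/2) and its reverse in L^(p/2) split off the squares of the
    imaginary parts. It remains to compare 1 + (w x)^2 with the p-norm and 1 + y^2 with the q-norm
    of a real function. *)
Lemma beckner_real (p q w x y : R) : 2 <= q -> p^-1 + q^-1 = 1 ->
  w = Num.sqrt (p - 1) ->
  nrm q (fun b => Num.sqrt ((1 - sgb b * (w * y)) ^+ 2 + (w * x) ^+ 2)) <=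
  nrm p (fun b => Num.sqrt ((1 + sgb b * x) ^+ 2 + y ^+ 2)).
Proof.
move=> q2 pq ew; have q0 : 0 < q by lra.
have eq' : p = q / (q - 1).
  have : p^-1 = (q - 1) / q by rewrite -[LHS](addrK q^-1) pq; field; rewrite gt_eqF.
  by move/(congr1 GRing.inv); rewrite invrK invf_div.
have q1 : 0 < q - 1 by lra.
(* Conjugacy makes w^2 equal to both (p - 1)/(2 - 1) and (2 - 1)/(q - 1), the ratios needed for p ->
   2 and for 2 -> q. *)
have ep : p - 1 = (q - 1)^-1 by rewrite eq'; field; rewrite gt_eqF.
have p1 : 1 < p by rewrite -subr_gt0 ep invr_gt0.
have p2 : p <= 2.
  have h : p - 1 <= 1 by rewrite ep invf_le1//; lra.
  lra.
have p0 : 0 < p by lra.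
have w0 : 0 < w by rewrite ew sqrtr_gt0 subr_gt0.
have w2 : w ^+ 2 = p - 1 by rewrite ew sqr_sqrtr// ltW// subr_gt0.
rewrite -(@ler_pXn2r _ 2)// ?nnegrE ?nrm_ge0// !nrm_sqr//.
rewrite (@eq_nrm _ _ _ _ (fun b => (1 - sgb b * (w * y)) ^+ 2 + (w * x) ^+ 2)); last first.
  by move=> b; rewrite sqr_sqrtr// addr_ge0 ?sqr_ge0.
rewrite (@eq_nrm _ _ (p / 2) _ (fun b => (1 + sgb b * x) ^+ 2 + y ^+ 2)); last first.
  by move=> b; rewrite sqr_sqrtr// addr_ge0 ?sqr_ge0.
have h1 : 1 <= q / 2 by rewrite ler_pdivlMr// mul1r.
have h2 : 0 < p / 2 by rewrite divr_gt0.
have h3 : p / 2 <= 1 by rewrite ler_pdivrMr// mul1r.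
apply: le_trans (minkowski_avg h1 (fun b => sqr_ge0 _) (fun b => sqr_ge0 _)) _.
apply: le_trans _ (rev_minkowski_bool h2 h3 (sqr_ge0 _) (fun b => sqr_ge0 _)).
rewrite (nrm_cst true) ?sqr_ge0//; last by lra.
have sqn (s : R) (F : bool -> R) : 0 < s ->
    nrm (s / 2) (fun b => F b ^+ 2) = nrm s (fun b => `|F b|) ^+ 2.
  move=> s0; rewrite nrm_sqr//; apply: eq_nrm => b.
  by rewrite real_normK ?num_real.
rewrite !sqn//.
have A1 : 1 + (w * x) ^+ 2 <= nrm p (fun b => `|1 + sgb b * x|) ^+ 2.
  rewrite -nrm2_sgb ler_pXn2r ?nnegrE ?nrm_ge0//.
  by apply: two_point_sgb => //; rewrite w2 (_ : 2 - 1 = 1) ?divr1//; ring.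
have A2 : nrm q (fun b => `|1 - sgb b * (w * y)|) ^+ 2 <= 1 + y ^+ 2.
  have -> : 1 + y ^+ 2 = 1 + (- y) ^+ 2 by rewrite sqrrN.
  rewrite -nrm2_sgb ler_pXn2r ?nnegrE ?nrm_ge0//.
  rewrite (@eq_nrm _ _ _ _ (fun b => `|1 + sgb b * (w * - y)|)); last first.
    by move=> b; rewrite mulrN mulrN.
  apply: two_point_sgb => //; first by lra.
  by rewrite w2 ep (_ : 2 - 1 = 1) ?div1r//; ring.
lra.
Qed.

Definition cnoise (z : R[i]) (f : bool -> R[i]) (b : bool) : R[i] :=
  ((1 + z) * f b + (1 - z) * f (~~ b)) / 2.

Definition two_point_contraction (p q : R) (z : R[i]) : Prop :=
  forall f : bool -> R[i],
    nrm q (fun b => normc (cnoise z f b)) <= nrm p (fun b => normc (f b)).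

(** For real r in [0, 1] the modulus of the noise is at most the noise of the modulus, which reduces
    complex f to the nonnegative function |f|. *)
Lemma two_point_bonami (p q r : R) : 1 < p -> p <= q -> 0 < r ->
  r ^+ 2 = (p - 1) / (q - 1) -> two_point_contraction p q r%:C%C.
Proof.
move=> p1 pq r0 er f; have q1 : 1 < q by apply: lt_le_trans pq.
have r1 : r <= 1.
  rewrite -(@expr_le1 _ 2)// ?(ltW r0)// er ler_pdivrMr ?subr_gt0// mul1r; lra.
apply: le_trans (two_point p1 pq r0 er (fun b => normc_ge0 (f b))).
apply: ler_nrm => [|b|b]; [exact: lt_trans q1|exact: normc_ge0|].
have r1' : 0 <= 1 - r by rewrite subr_ge0.
have r2' : 0 <= 1 + r by rewrite addr_ge0 ?(ltW r0).
rewrite /cnoise /noise Normc.normcM Normc.normcV.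
have -> : normc 2 = 2 by rewrite -[2 in LHS](rmorph_nat (real_complex R) 2) normc_real ger0_norm.
rewrite ler_pM2r ?invr_gt0//; apply: le_trans (le_normcD _ _) _.
rewrite !Normc.normcM -(rmorph1 (real_complex R)) -rmorphD -rmorphB !normc_real.
by rewrite !ger0_norm.
Qed.

Lemma two_point_beckner (p q : R) : 2 <= q -> p^-1 + q^-1 = 1 ->
  two_point_contraction p q (0 +i* Num.sqrt (p - 1))%C.
Proof.
move=> q2 pq f.
set w := Num.sqrt (p - 1).
pose a := (f false + f true) / 2; pose d := (f false - f true) / 2.
have ef b : f b = a + (sgb b)%:C%C * d.
  by case: b; rewrite /sgb /a /d ?rmorphN rmorph1; field.
have en b : cnoise (0 +i* w)%C f b = a + (sgb b)%:C%C * ((0 +i* w)%C * d).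
  by case: b; rewrite /cnoise /= /sgb /a /d ?rmorphN rmorph1; field.
have nsg b : normc (sgb b)%:C%C = 1.
  by rewrite normc_real /sgb; case: b; rewrite ?normrN1 ?normr1.
have q0 : 0 < q by lra.
have p0' : 0 < p^-1.
  by have : q^-1 < 1 by [rewrite invf_lt1//; lra]; lra.
have p0 : 0 < p by rewrite -invr_gt0.
(* If the mean [a] vanishes, both moduli are constant and w <= 1 suffices. Otherwise dividing by [a]
   normalizes f to 1 + sgb b (x + i y). *)
have [a0|a0] := eqVneq a 0.
  have w0 : 0 <= w by exact: sqrtr_ge0.
  have w1 : w <= 1.
    have h : q^-1 <= 2^-1 by rewrite lef_pV2 ?posrE.
    have : 2^-1 <= p^-1 by lra.
    rewrite lef_pV2 ?posrE// => p2.
    by rewrite /w -[leRHS]sqrtr1 ler_wsqrtr//; lra.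
  have e1 b : normc (f b) = normc d by rewrite ef a0 add0r Normc.normcM nsg mul1r.
  have e2 b : normc (cnoise (0 +i* w)%C f b) = w * normc d.
    rewrite en a0 add0r !Normc.normcM nsg mul1r; congr (_ * _).
    by rewrite /= expr0n add0r sqrtr_sqr ger0_norm.
  rewrite (eq_nrm _ e1) (eq_nrm _ e2) !(nrm_cst true) ?mulr_ge0 ?normc_ge0//.
  by rewrite ler_piMl ?normc_ge0.
pose x := complex.Re (d / a); pose y := complex.Im (d / a).
have ed : d = a * (x +i* y)%C.
  have -> : (x +i* y)%C = d / a by rewrite /x /y; case: (d / a).
  by rewrite mulrC divfK.
have e1 b : normc (f b) = normc a * Num.sqrt ((1 + sgb b * x) ^+ 2 + y ^+ 2).
  rewrite ef ed mulrCA -[X in X + _]mulr1 -mulrDr Normc.normcM; congr (_ * _).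
  rewrite /= !mul0r subr0 addr0 add0r exprMn.
  by rewrite [sgb b ^+ 2](_ : _ = 1) ?mul1r// /sgb; case: b; rewrite ?sqrrN expr1n.
have e2 b : normc (cnoise (0 +i* w)%C f b) =
    normc a * Num.sqrt ((1 - sgb b * (w * y)) ^+ 2 + (w * x) ^+ 2).
  rewrite en ed ![_ * (a * _)]mulrCA -[X in X + _]mulr1 -mulrDr Normc.normcM.
  congr (_ * _); rewrite /= !mul0r !sub0r !addr0 !add0r subr0 mulrN exprMn.
  by rewrite [sgb b ^+ 2](_ : _ = 1) ?mul1r// /sgb; case: b; rewrite ?sqrrN expr1n.
rewrite (eq_nrm _ e1) (eq_nrm _ e2) !nrmZ ?normc_ge0//.
by rewrite ler_wpM2l ?normc_ge0//; apply: beckner_real.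
Qed.

End ComplexTwoPoint.

(** * Tensorization *)

Section CubeInduction.

Definition cube_cons n (b : bool) (x : cube n) : cube n.+1 :=
  [ffun i => if unlift ord0 i is Some j then x j else b].

Lemma cube_cons0 n b (x : cube n) : cube_cons b x ord0 = b.
Proof. by rewrite ffunE unlift_none. Qed.

Lemma cube_consS n b (x : cube n) j : cube_cons b x (lift ord0 j) = x j.
Proof. by rewrite ffunE liftK. Qed.

Lemma sum_cube_cons (V : nmodType) n (F : cube n.+1 -> V) :
  \sum_x F x = \sum_(b : bool) \sum_(x : cube n) F (cube_cons b x).
Proof.
rewrite pair_big /= (reindex (fun p : bool * cube n => cube_cons p.1 p.2))//.
exists (fun y : cube n.+1 => (y ord0, [ffun j => y (lift ord0 j)])).
  move=> [b x] _ /=; rewrite cube_cons0; congr (_, _).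
  by apply/ffunP => j; rewrite ffunE cube_consS.
move=> y _; apply/ffunP => i; rewrite ffunE /=.
by case: unliftP => [j ->|->//]; rewrite ffunE.
Qed.

Lemma card_cube n : #|{: cube n}| = (2 ^ n)%N.
Proof. by rewrite card_ffun card_bool card_ord. Qed.

Lemma sum_cube_prod (S : comPzSemiRingType) n (H : 'I_n -> bool -> S) :
  \sum_(x : cube n) \prod_i H i (x i) = \prod_i \sum_b H i b.
Proof. by rewrite bigA_distr_bigA. Qed.

(** A strictly increasing tuple has distinct entries. As a product over all coordinates, the
    monomial can be averaged coordinate by coordinate. *)
Lemma prod_sorted_tuple (S : comPzSemiRingType) d n (t : d.-tuple 'I_n) (F : 'I_n -> S) :
  sorted ltn (map val t) ->
  \prod_(k < d) F (tnth t k) = \prod_i (if i \in t then F i else 1).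
Proof.
move=> st; rewrite -big_mkcond /= -(big_tuple _ _ t xpredT F) /= big_uniq//=.
rewrite -(map_inj_uniq val_inj); apply: sorted_uniq st; last exact: ltnn.
exact: ltn_trans.
Qed.

Context {R : realType}.
Local Notation normc := (@Normc.normc R).
Local Notation sgn b := ((-1) ^+ nat_of_bool b : R[i]).

Lemma avg_cube_cons n (F : cube n.+1 -> R) :
  avg F = avg (fun x : cube n => avg (fun b => F (cube_cons b x))).
Proof.
rewrite !avg.unlock sum_cube_cons exchange_big /= -[in RHS]big_distrl /=.
rewrite -mulrA -invfM -natrM; congr (_ / _%:R).
by rewrite !card_cube card_bool expnS.
Qed.

Lemma avg_exchange (S T : finType) (F : S -> T -> R) :
  avg (fun x => avg (F x)) = avg (fun y => avg (F^~ y)).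
Proof.
rewrite !avg.unlock -!big_distrl /= exchange_big /=.
by rewrite mulrAC.
Qed.

Lemma nrm_cube_cons n (p : R) (F : cube n.+1 -> R) : 0 < p ->
  nrm p F = nrm p (fun x : cube n => nrm p (fun b => F (cube_cons b x))).
Proof.
move=> p0; rewrite [LHS]nrm_def [RHS]nrm_def avg_cube_cons; congr (_ `^ _).
by apply: eq_avg => x; rewrite nrm_powR// gt_eqF.
Qed.

Lemma nrm_exchange (S T : finType) (p : R) (F : S -> T -> R) : 0 < p ->
  nrm p (fun x => nrm p (F x)) = nrm p (fun y => nrm p (F^~ y)).
Proof.
move=> p0; rewrite [LHS]nrm_def [RHS]nrm_def.
rewrite (eq_avg (g := fun x => avg (fun y => F x y `^ p))); last first.
  by move=> x; rewrite nrm_powR// gt_eqF.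
rewrite [in RHS](eq_avg (g := fun y => avg (fun x => F x y `^ p))); last first.
  by move=> x; rewrite nrm_powR// gt_eqF.
by rewrite avg_exchange.
Qed.

Lemma ler_of_powR (p a b : R) : 0 < p -> 0 <= a -> 0 <= b ->
  a `^ p <= b `^ p -> a <= b.
Proof.
move=> p0 a0 b0 ab; rewrite -(powRK a0 (lt0r_neq0 p0)) -(powRK b0 (lt0r_neq0 p0)).
by rewrite ge0_ler_powR ?nnegrE ?invr_ge0 ?(ltW p0) ?powR_ge0.
Qed.

(** Raised to the power p, this is the triangle inequality in L^(q/p) for the two functions F b ^ p
    / 2. *)
Lemma minkowski_bool (T : finType) (p q : R) (F : bool -> T -> R) :
  0 < p -> p <= q -> (forall b x, 0 <= F b x) ->
  nrm q (fun x => nrm p (F^~ x)) <= nrm p (fun b => nrm q (F b)).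
Proof.
move=> p0 pq F0; have q0 : 0 < q by apply: lt_le_trans pq.
have s1 : 1 <= q / p by rewrite ler_pdivlMr// mul1r.
have s0 : 0 < q / p by rewrite divr_gt0.
apply: (@ler_of_powR p) => //; rewrite ?nrm_ge0// [leRHS]nrm_powR ?gt_eqF//.
rewrite nrm_powR_powR// => [|x]; last exact: nrm_ge0.
rewrite (eq_nrm _ (g := fun x => 2^-1 * F true x `^ p + 2^-1 * F false x `^ p)); last first.
  by move=> x; rewrite nrm_powR ?gt_eqF// avg_bool mulrDl !(mulrC _^-1).
have F1 b x : 0 <= 2^-1 * F b x `^ p by rewrite mulr_ge0 ?invr_ge0 ?powR_ge0.
apply: le_trans (minkowski_avg s1 (F1 true) (F1 false)) _.
rewrite !nrmZ ?invr_ge0// => [|x|x]; try exact: powR_ge0.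
by rewrite avg_bool -mulrDr mulrC !nrm_powR_powR.
Qed.

(** The kernel form of w_S |-> z^|S| w_S: expanded, the product is the sum over S of z^|S| w_S(x)
    w_S(y). *)
Definition cube_noise (z : R[i]) n (f : cube n -> R[i]) (x : cube n) : R[i] :=
  (\sum_y f y * \prod_i (1 + z * Defs.coord R x i * Defs.coord R y i)) / 2 ^+ n.

Lemma cube_noise_cons z n (f : cube n.+1 -> R[i]) b x :
  cube_noise z f (cube_cons b x) =
  cnoise z (fun b' => cube_noise z (fun y => f (cube_cons b' y)) x) b.
Proof.
have h c : \sum_(y : cube n) f (cube_cons c y) *
     \prod_i (1 + z * Defs.coord R (cube_cons b x) i * Defs.coord R (cube_cons c y) i) =
   (1 + z * sgn b * sgn c) *
     \sum_(y : cube n) f (cube_cons c y) * \prod_i (1 + z * Defs.coord R x i * Defs.coord R y i).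
  rewrite big_distrr /=; apply: eq_bigr => y _.
  rewrite big_ord_recl /Defs.coord !cube_cons0 mulrCA; congr (_ * (_ * _)).
  by apply: eq_bigr => i _; rewrite !cube_consS.
have N0 : (2 ^+ n : R[i]) != 0 by rewrite expf_eq0 pnatr_eq0 andbF.
rewrite /cube_noise /cnoise sum_cube_cons big_bool /= !h exprS.
pose S c := \sum_(y : cube n) f (cube_cons c y) * \prod_i (1 + z * Defs.coord R x i * Defs.coord R y i).
rewrite -/(S true) -/(S false) -/(S b) -/(S (~~ b)).
move: (2 ^+ n) N0 => N N0.
by case: b {h}; rewrite /= ?expr1 ?expr0; field; rewrite N0.
Qed.

(** Induction on n: the two-point contraction acts in the first coordinate, [minkowski_bool] moves
    the q-norm over the remaining coordinates inside, and the induction hypothesis applies there. *)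
Lemma cube_noise_contraction (p q : R) (z : R[i]) : 0 < p -> p <= q ->
  two_point_contraction p q z ->
  forall n (f : cube n -> R[i]),
    nrm q (fun x => normc (cube_noise z f x)) <= nrm p (fun x => normc (f x)).
Proof.
move=> p0 pq hz; have q0 : 0 < q by apply: lt_le_trans pq.
elim=> [|n IH] f.
  have x0 : cube 0 by exact: [ffun=> false].
  have ex (x : cube 0) : x = x0 by apply/ffunP; case.
  have e1 x : normc (cube_noise z f x) = normc (f x0).
    rewrite /cube_noise (eq_bigr (fun=> f x0)).
      by rewrite sumr_const card_cube divr1.
    by move=> y _; rewrite big_ord0 mulr1 (ex y).
  have e2 x : normc (f x) = normc (f x0) by rewrite (ex x).
  by rewrite (eq_nrm _ e1) (eq_nrm _ e2) !(nrm_cst x0)// normc_ge0.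
pose G b x := cube_noise z (fun y => f (cube_cons b y)) x.
rewrite nrm_cube_cons//.
apply: le_trans (_ : nrm q (fun x => nrm p (fun b => normc (G b x))) <= _).
  apply: ler_nrm => // x; first exact: nrm_ge0.
  rewrite (eq_nrm _ (g := fun b => normc (cnoise z (G^~ x) b))); first exact: hz.
  by move=> b; rewrite cube_noise_cons.
apply: le_trans (minkowski_bool p0 pq (fun b x => normc_ge0 (G b x))) _.
rewrite nrm_cube_cons// nrm_exchange//.
by apply: ler_nrm => // b; [exact: nrm_ge0|exact: IH].
Qed.

(** The sum of the kernel against a monomial factors over the coordinates: an index of the monomial
    contributes 2 z x_i, any other index 2, and the powers of 2 cancel. *)
Lemma cube_noise_homogeneous z d n (h : cube n -> R[i]) (x : cube n) :
  homogeneous d h -> cube_noise z h x = z ^+ d * h x.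
Proof.
move=> [a ha].
have N0 : (2 ^+ n : R[i]) != 0 by rewrite expf_eq0 pnatr_eq0 andbF.
rewrite /cube_noise.
under eq_bigr do rewrite ha big_distrl /=.
rewrite exchange_big /= ha big_distrr big_distrl /=; apply: eq_bigr => t st.
under eq_bigr do rewrite -mulrA (prod_sorted_tuple _ st) -big_split /=.
rewrite -big_distrr /= mulrCA -mulrA; congr (_ * _).
have := @sum_cube_prod R[i] n (fun i b => (if i \in t then sgn b else 1) * (1 + z * Defs.coord R x i * sgn b)).
rewrite /Defs.coord => ->.
rewrite (eq_bigr (fun i => 2 * (if i \in t then z * Defs.coord R x i else 1))); last first.
  by move=> i _; rewrite big_bool /Defs.coord; case: ifP => _; rewrite /= ?expr1 ?expr0; ring.
rewrite big_split /= prodr_const card_ord mulrAC divff// mul1r.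
by rewrite -prod_sorted_tuple// big_split /= prodr_const card_ord.
Qed.

Lemma cube_norm_nrm n (p : R) (h : cube n -> R[i]) :
  cube_norm p h = nrm p (fun x => normc (h x)).
Proof. by rewrite nrm.unlock avg.unlock. Qed.

Lemma homogeneous_hypercontractive (p q : R) (z : R[i]) d n (h : cube n -> R[i]) :
  0 < p -> p <= q -> two_point_contraction p q z -> homogeneous d h ->
  normc z ^+ d * cube_norm q h <= cube_norm p h.
Proof.
move=> p0 pq hz hh; have q0 : 0 < q by apply: lt_le_trans pq.
rewrite !cube_norm_nrm.
apply: le_trans (cube_noise_contraction p0 pq hz h).
rewrite -nrmZ ?exprn_ge0 ?normc_ge0//; last by move=> x; exact: normc_ge0.
rewrite le_eqVlt; apply/orP; left; apply/eqP; apply: eq_nrm => x.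
rewrite (cube_noise_homogeneous _ _ hh) Normc.normcM; congr (_ * _).
by elim: d {hh} => [|d IHd]; rewrite ?expr0 ?Normc.normc1// !exprS Normc.normcM IHd.
Qed.

End CubeInduction.

(** * Upper bounds *)

Section UpperBounds.
Context {R : realType}.
Local Notation normc := (@Normc.normc R).

Lemma powR_half (K : R) (d : nat) : 0 <= K -> K `^ (d%:R / 2) = Num.sqrt K ^+ d.
Proof. by move=> K0; rewrite mulrC powRrM powR12_sqrt// powR_mulrn. Qed.

Lemma homogeneous_bound (p q K : R) (z : R[i]) d n (h : cube n -> R[i]) :
  0 < p -> p <= q -> 0 < K -> normc z * Num.sqrt K = 1 ->
  two_point_contraction p q z -> homogeneous d h ->
  cube_norm q h <= K `^ (d%:R / 2) * cube_norm p h.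
Proof.
move=> p0 pq K0 zK hz hh.
have := homogeneous_hypercontractive p0 pq hz hh.
have S0 : 0 < Num.sqrt K ^+ d by rewrite exprn_gt0// sqrtr_gt0.
rewrite -(ler_pM2l S0) mulrA -exprMn [Num.sqrt K * _]mulrC zK expr1n mul1r.
by rewrite powR_half ?(ltW K0).
Qed.

Lemma homogeneous_bonami (p q : R) d n (h : cube n -> R[i]) :
  1 < p -> p <= q -> homogeneous d h ->
  cube_norm q h <= ((q - 1) / (p - 1)) `^ (d%:R / 2) * cube_norm p h.
Proof.
move=> p1 pq; have q1 : 1 < q by apply: lt_le_trans pq.
have K0 : 0 < (q - 1) / (p - 1) by rewrite divr_gt0 ?subr_gt0.
pose r := Num.sqrt ((p - 1) / (q - 1)).
have r0 : 0 < r by rewrite sqrtr_gt0 divr_gt0 ?subr_gt0.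
apply: (@homogeneous_bound _ _ _ r%:C%C) => //; first by apply: lt_trans p1.
  rewrite normc_real gtr0_norm// /r -sqrtrM ?divr_ge0 ?subr_ge0 ?ltW//.
  by rewrite mulrA divfK ?divff ?sqrtr1// gt_eqF// subr_gt0.
apply: two_point_bonami => //.
by rewrite sqr_sqrtr// divr_ge0 ?subr_ge0 ?ltW.
Qed.

Lemma homogeneous_beckner (p q : R) d n (h : cube n -> R[i]) :
  2 <= q -> p^-1 + q^-1 = 1 -> homogeneous d h ->
  cube_norm q h <= (q - 1) `^ (d%:R / 2) * cube_norm p h.
Proof.
move=> q2 pq; have q0 : 0 < q by lra.
have q1 : 0 < q - 1 by lra.
have ep : p = q / (q - 1).
  have : p^-1 = (q - 1) / q by rewrite -[LHS](addrK q^-1) pq; field; rewrite gt_eqF.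
  by move/(congr1 GRing.inv); rewrite invrK invf_div.
have ep1 : p - 1 = (q - 1)^-1 by rewrite ep; field; rewrite gt_eqF.
have p0 : 0 < p by rewrite ep divr_gt0.
have lepq : p <= q by rewrite ep ler_pdivrMr//; nra.
apply: homogeneous_bound (two_point_beckner q2 pq) => //.
rewrite /= expr0n add0r sqrtr_sqr ger0_norm ?sqrtr_ge0//.
by rewrite ep1 -sqrtrM ?invr_ge0 ?(ltW q1)// mulVf ?sqrtr1// gt_eqF.
Qed.

(** * Convexity of the logarithm of the norm in the reciprocal exponent *)

Section LogConvexity.
Variables (T : finType) (f : T -> R) (x0 : T).
Hypotheses (f0 : forall x, 0 <= f x) (fx0 : 0 < f x0).

Let L s := ln (nrm s^-1 f).

Lemma avg_powR_gt0 p : 0 < p -> 0 < avg (fun x => f x `^ p).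
Proof.
move=> p0; have h : 0 <= avg (fun x => f x `^ p) by apply: avg_ge0 => x; exact: powR_ge0.
rewrite lt_def h andbT; apply/eqP => /(avg_eq0 x0) e.
have := powR_gt0 p fx0; rewrite e ?ltxx// => x; exact: powR_ge0.
Qed.

Lemma nrm_gt0 p : 0 < p -> 0 < nrm p f.
Proof. by move=> p0; rewrite nrm_def powR_gt0// avg_powR_gt0. Qed.

Lemma ln_nrm_convex x y z : 0 < x -> x < y -> y < z ->
  L y * (z - x) <= L x * (z - y) + L z * (y - x).
Proof.
move=> xp xy yz; have yp : 0 < y by apply: lt_trans xy.
have zp : 0 < z by apply: lt_trans yz.
have zx : 0 < z - x by rewrite subr_gt0 (lt_trans xy).
have Ls s : L s = s * ln (avg (fun x => f x `^ s^-1)).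
  by rewrite /L nrm_def invrK ln_powR.
(* The weight for which a/x + (1 - a)/z = 1/y, as Lyapunov's inequality requires. *)
pose a := x * (z - y) / (y * (z - x)).
have a1 : 1 - a = z * (y - x) / (y * (z - x)).
  by rewrite /a; field; rewrite !gt_eqF.
have a01 : 0 < a < 1.
  by rewrite -[a < 1]subr_gt0 a1 !divr_gt0 ?mulr_gt0// subr_gt0.
have e : a * x^-1 + (1 - a) * z^-1 = y^-1.
  by rewrite a1 /a; field; rewrite !gt_eqF.
have xi : 0 < x^-1 by rewrite invr_gt0.
have zi : 0 < z^-1 by rewrite invr_gt0.
have yi : 0 < y^-1 by rewrite invr_gt0.
have := lyapunov_avg xi zi a01 f0; rewrite e.
rewrite -ler_ln ?posrE ?mulr_gt0 ?powR_gt0 ?avg_powR_gt0//.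
rewrite !Ls.
have := avg_powR_gt0 zi; have := avg_powR_gt0 xi.
move: (avg _) (avg _) (avg _) => Ay Az Ax Ax0 Az0.
rewrite lnM ?posrE ?powR_gt0// !ln_powR.
move: (ln Ay) (ln Ax) (ln Az) => l1 l2 l3.
have yzx : 0 < y * (z - x) by rewrite mulr_gt0.
rewrite -(ler_pM2l yzx) a1 /a => H.
rewrite [leLHS](_ : _ = y * (z - x) * l1); last by ring.
apply: le_trans H _; rewrite le_eqVlt; apply/orP; left; apply/eqP.
by field; rewrite !gt_eqF.
Qed.

(** Chord slopes of a convex function increase to the right; the chord from s0 to b lies between the
    two in slope. *)
Lemma ln_nrm_chords s0 s1 a b : 0 < s0 -> s0 < s1 -> s1 < b -> s0 < a -> a < b ->
  (L a - L b) * (s1 - s0) <= (b - a) * (L s0 - L s1).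
Proof.
move=> s00 s01 s1b s0a ab.
have H1 := ln_nrm_convex s00 s01 s1b.
have H2 := ln_nrm_convex s00 s0a ab.
have bs : 0 < b - s0 by rewrite subr_gt0 (lt_trans s01).
have s10 : 0 <= s1 - s0 by rewrite subr_ge0 ltW.
have ba : 0 <= b - a by rewrite subr_ge0 ltW.
have h1 : (L s0 - L b) * (s1 - s0) <= (L s0 - L s1) * (b - s0) by lra.
have h2 : (L a - L b) * (b - s0) <= (L s0 - L b) * (b - a) by lra.
rewrite -(ler_pM2r bs).
have := ler_wpM2l ba h1; have := ler_wpM2r s10 h2.
move: (L s0) (L s1) (L a) (L b) => l0 l1 la lb.
by lra.
Qed.

End LogConvexity.

(** * The cases of the upper bound *)

Lemma cube_norm_cases n (h : cube n -> R[i]) :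
  (forall p : R, 0 < p -> cube_norm p h = 0) \/ exists x, 0 < normc (h x).
Proof.
have [[x hx]|H] := pselect (exists x, 0 < normc (h x)); first by right; exists x.
left=> p p0; rewrite cube_norm_nrm (eq_nrm _ (g := fun=> 0)) ?nrm0// => x.
by apply/eqP; rewrite eq_le normc_ge0 andbT leNgt; apply/negP => hx; apply: H; exists x.
Qed.

(** In the variable s = 1/q conjugation is s |-> 1 - s, so the two norms sit symmetrically about s =
    1/2. *)
Lemma ln_homogeneous_beckner (x : R) d n (h : cube n -> R[i]) :
  0 < x -> x <= 2^-1 -> homogeneous d h -> (exists y, 0 < normc (h y)) ->
  ln (nrm x^-1 (fun y => normc (h y))) <=
  d%:R / 2 * ln (x^-1 - 1) + ln (nrm (1 - x)^-1 (fun y => normc (h y))).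
Proof.
move=> x0 x2 hh [y0 hy].
have q2 : 2 <= x^-1 by rewrite -[2]invrK lef_pV2 ?posrE.
have := @homogeneous_beckner (1 - x)^-1 x^-1 d n h q2.
rewrite !invrK subrK => /(_ erefl hh); rewrite !cube_norm_nrm.
have n0 (s : R) : 0 < s -> 0 < nrm s^-1 (fun y => normc (h y)).
  by move=> s0; apply: (nrm_gt0 (x0 := y0)) => //; rewrite ?invr_gt0// => y; exact: normc_ge0.
have x1 : 0 < 1 - x by lra.
have qq : 0 < x^-1 - 1 by lra.
rewrite -ler_ln ?posrE ?mulr_gt0 ?powR_gt0 ?n0//.
by rewrite lnM ?posrE ?powR_gt0 ?n0// ln_powR.
Qed.

(** Convexity is used at 1/q < 1 - 1/q < 1/p. The conjugate bound controls the descent from 1/q to 1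
    - 1/q, and extending the chord to 1/p multiplies it by the ratio of lengths. *)
Lemma homogeneous_mixed (p q : R) d n (h : cube n -> R[i]) :
  1 <= p -> p <= 2 -> 2 < q -> 1 < p^-1 + q^-1 -> homogeneous d h ->
  cube_norm q h <= (q - 1) `^ ((q - p) / (p * (q - 2)) * (d%:R / 2)) * cube_norm p h.
Proof.
move=> p1 p2 q2 pq hh; have p0 : 0 < p by lra.
have q0 : 0 < q by lra.
have [h0|[y0 hy]] := cube_norm_cases h; first by rewrite !h0// mulr0.
pose f y := normc (h y); pose L (s : R) := ln (nrm s^-1 f).
have f0 y : 0 <= f y by exact: normc_ge0.
have n0 (s : R) : 0 < s -> 0 < nrm s f by exact: (@nrm_gt0 _ f y0 hy).
have x0 : 0 < q^-1 by rewrite invr_gt0.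
have x2 : q^-1 < 2^-1 by rewrite ltf_pV2 ?posrE.
have xy : q^-1 < 1 - q^-1 by lra.
have yz : 1 - q^-1 < p^-1 by lra.
have H1 := ln_homogeneous_beckner x0 (ltW x2) hh (ex_intro _ y0 hy).
have H2 := @ln_nrm_convex _ f y0 f0 hy _ _ _ x0 xy yz.
rewrite /= -/f -/(L _) -/(L _) invrK in H1; rewrite -/(L _) -/(L _) -/(L _) in H2.
have q1 : 0 < q - 1 by lra.
rewrite !cube_norm_nrm -/f -ler_ln ?posrE ?mulr_gt0 ?powR_gt0 ?n0//.
rewrite lnM ?posrE ?powR_gt0 ?n0// ln_powR.
have -> : ln (nrm q f) = L q^-1 by rewrite /L invrK.
have -> : ln (nrm p f) = L p^-1 by rewrite /L invrK.
have yx : 0 < 1 - q^-1 - q^-1 by lra.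
(* The exponent is this ratio of lengths. *)
have -> : (q - p) / (p * (q - 2)) = (p^-1 - q^-1) / (1 - q^-1 - q^-1).
  have q20 : q - 2 != 0 by rewrite gt_eqF// subr_gt0.
  have -> : p^-1 - q^-1 = (q - p) / (p * q) by field; rewrite !gt_eqF.
  have -> : 1 - q^-1 - q^-1 = (q - 2) / q by field; rewrite !gt_eqF.
  by field; rewrite q20 !gt_eqF.
have zx : 0 <= p^-1 - q^-1 by lra.
have {}H1 := ler_wpM2r zx H1.
rewrite -(ler_pM2r yx).
rewrite [leRHS](_ : _ = (p^-1 - q^-1) * (d%:R / 2 * ln (q - 1)) + L p^-1 * (1 - q^-1 - q^-1)); last first.
  move: (L p^-1) (ln _) (p^-1) (q^-1) yx => l1 l2 pi qi yx.
  by field; rewrite gt_eqF.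
move: (L p^-1) (L q^-1) (L (1 - q^-1)) (ln _) H1 H2 => l1 l2 l3 l4 H1 H2; lra.
Qed.

(** A convex function descends fastest on its leftmost chord. The descent on [1/q, 1/p] is compared
    with that on [1/2 - e, 1/2 + e], where the conjugate bound applies; then e tends to 0. *)
Lemma homogeneous_low (p q : R) d n (h : cube n -> R[i]) :
  1 <= p -> p <= q -> q <= 2 -> homogeneous d h ->
  cube_norm q h <= expR ((p^-1 - q^-1) * d%:R) * cube_norm p h.
Proof.
move=> p1 pq q2 hh; have p0 : 0 < p by lra.
have q0 : 0 < q by lra.
have [h0|[y0 hy]] := cube_norm_cases h; first by rewrite !h0// mulr0.
have [->|pNq] := eqVneq p q; first by rewrite subrr mul0r expR0 mul1r.
have {pNq}pq : p < q by rewrite lt_neqAle pNq.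
pose f y := normc (h y); pose L (s : R) := ln (nrm s^-1 f).
have f0 y : 0 <= f y by exact: normc_ge0.
have n0 (s : R) : 0 < s -> 0 < nrm s f by exact: (@nrm_gt0 _ f y0 hy).
rewrite !cube_norm_nrm -/f -ler_ln ?posrE ?mulr_gt0 ?expR_gt0 ?n0//.
rewrite lnM ?posrE ?expR_gt0 ?n0// expRK.
have -> : ln (nrm q f) = L q^-1 by rewrite /L invrK.
have -> : ln (nrm p f) = L p^-1 by rewrite /L invrK.
have a2 : 2^-1 <= q^-1 by rewrite lef_pV2 ?posrE.
have ab : q^-1 < p^-1 by rewrite ltf_pV2 ?posrE.
rewrite -lerBlDr.
set X := L q^-1 - L p^-1; set Y := _ * d%:R.
have key (e : R) : 0 < e -> e < 4^-1 -> e < p^-1 - 2^-1 -> X * (1 - 2 * e) <= Y.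
  move=> e0 e4 eb; pose s0 := 2^-1 - e.
  have s00 : 0 < s0 by rewrite /s0; lra.
  have s02 : s0 <= 2^-1 by rewrite /s0; lra.
  have H1 := ln_homogeneous_beckner s00 s02 hh (ex_intro _ y0 hy).
  rewrite /= -/f -/(L _) -/(L _) in H1.
  have H2 : X * (1 - s0 - s0) <= (p^-1 - q^-1) * (L s0 - L (1 - s0)).
    by apply: (@ln_nrm_chords _ f y0 f0 hy _ _ _ _ s00) => //; rewrite /s0; lra.
  (* The constant q - 1 at q = 1/s0; ln (1 + u) <= u makes its logarithm comparable to the chord
     length 2 e. *)
  have s0V : s0^-1 - 1 = 1 + 2 * e / s0.
    have -> : s0^-1 - 1 = (1 - s0) / s0 by field; rewrite gt_eqF.
    have -> : 1 - s0 = s0 + 2 * e by rewrite /s0; field.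
    by rewrite mulrDl divff// gt_eqF.
  have H3 : ln (s0^-1 - 1) <= 2 * e / s0.
    have h0 : 0 <= 2 * e / s0 by apply: divr_ge0; lra.
    by rewrite s0V le_ln1Dx//; lra.
  have ba : 0 <= p^-1 - q^-1 by lra.
  have d0 : 0 <= d%:R / 2 :> R by rewrite divr_ge0.
  have H4 : L s0 - L (1 - s0) <= d%:R / 2 * (2 * e / s0).
    have := ler_wpM2l d0 H3; lra.
  have := ler_wpM2l ba H4.
  have -> : (p^-1 - q^-1) * (d%:R / 2 * (2 * e / s0)) = Y * (e / s0).
    by rewrite /Y; field; rewrite !gt_eqF.
  move=> H5; have := le_trans H2 H5.
  have c0 : 0 <= s0 / e by rewrite divr_ge0 ?ltW.
  move/(ler_wpM2r c0).
  rewrite (_ : X * _ * _ = X * (1 - 2 * e)); last by rewrite /s0; field; rewrite gt_eqF.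
  by rewrite (_ : Y * _ * _ = Y)//; field; rewrite !gt_eqF.
have Y0 : 0 <= Y by rewrite mulr_ge0// subr_ge0 ltW.
rewrite leNgt; apply/negP => YX.
have X0 : 0 < X by apply: le_lt_trans YX.
have b2 : 0 < p^-1 - 2^-1 by lra.
(* The first two bounds meet the hypotheses of [key]; the third gives 2 e X <= (X - Y)/2, which
   contradicts its conclusion when X > Y. *)
pose e := Num.min 8^-1 (Num.min ((p^-1 - 2^-1) / 2) ((X - Y) / (4 * X))).
have e0 : 0 < e.
  by rewrite !lt_min; apply/and3P; split; rewrite ?invr_gt0//; apply: divr_gt0; lra.
have e1 : e <= 8^-1 by rewrite !ge_min lexx.
have e2 : e <= (p^-1 - 2^-1) / 2 by rewrite !ge_min lexx orbT.
have e3 : e * (4 * X) <= X - Y.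
  by rewrite -ler_pdivlMr ?mulr_gt0// !ge_min lexx !orbT.
have : X * (1 - 2 * e) <= Y by apply: key; lra.
lra.
Qed.

Lemma homogeneous_chaos_const (p q : R) d n (h : cube n -> R[i]) :
  1 <= p -> p <= q -> homogeneous d h ->
  cube_norm q h <= chaos_const p q d * cube_norm p h.
Proof.
move=> p1 pq hh; have p0 : 0 < p by lra.
have q1 : 1 <= q by lra.
rewrite /chaos_const p1 pq /=.
have [q2|q2] := leP q 2; first exact: homogeneous_low.
have [p2|p2] := leP p 2; last first.
  by apply: homogeneous_bonami => //; lra.
have [pq1|pq1] := ltP 1; first exact: homogeneous_mixed.
rewrite (ltW q2) /=.
have qi : q^-1 <= 2^-1 by rewrite lef_pV2 ?posrE; lra.
have pi : p^-1 <= 1 - q^-1 by lra.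
(* The exponent conjugate to q is at most p, so the conjugate bound passes to p by monotonicity of
   norms. *)
apply: le_trans (@homogeneous_beckner (1 - q^-1)^-1 _ _ _ _ (ltW q2) _ hh) _.
  by rewrite invrK subrK.
apply: ler_wpM2l; first exact: powR_ge0.
rewrite !cube_norm_nrm; apply: nrm_mono.
- by rewrite invr_gt0; lra.
- by rewrite -[p]invrK lef_pV2 ?posrE ?invr_gt0//; lra.
- by move=> x; exact: normc_ge0.
Qed.

End UpperBounds.

(** * Sharpness *)

Section Sharpness.
Context {R : realType}.
Local Notation normc := (@Normc.normc R).

(** * Estimates for hyperbolic functions *)

Lemma sinh_ge (u : R) : 0 <= u -> 2 * u <= expR u - expR (- u).
Proof.
move=> u0; pose F (v : R) := expR v - expR (- v) - 2 * v.
suff : F 0 <= F u by rewrite /F oppr0 subrr mulr0 subr0 subr_ge0.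
apply: (@der_le _ F (fun v => expR v + expR (- v) - 2)) => [//|v _|v _].
  apply: der_eq.
    apply: derB; last by apply: derM; [exact: derC|exact: derI].
    apply: derB; apply: der_expR; first exact: derI.
    by apply: derN; exact: derI.
  by rewrite /=; ring.
have -> : expR v + expR (- v) - 2 = (expR (v / 2) - expR (- (v / 2))) ^+ 2.
  rewrite {1}(_ : v = 2 * (v / 2)); last by field.
  rewrite {1}(_ : - v = 2 * - (v / 2)); last by field.
  rewrite !expRM_natl expRN; field.
  by rewrite gt_eqF ?expR_gt0.
exact: sqr_ge0.
Qed.

Definition cosh (u : R) := (expR u + expR (- u)) / 2.

Lemma cosh_gt0 u : 0 < cosh u.
Proof. by rewrite divr_gt0// addr_gt0 ?expR_gt0. Qed.

(** 2 cosh u - 2 is the square of 2 sinh (u/2), which is at least u. *)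
Lemma cosh_ge (u : R) : 0 <= u -> 1 + u ^+ 2 / 2 <= cosh u.
Proof.
move=> u0; rewrite /cosh.
have e1 : expR u = expR (u / 2) ^+ 2 by rewrite -expRM_natl; congr expR; field.
have e2 : expR (- u) = expR (- (u / 2)) ^+ 2 by rewrite -expRM_natl; congr expR; field.
have e3 : expR (u / 2) * expR (- (u / 2)) = 1 by rewrite -expRD subrr expR0.
have h0 : 0 <= u / 2 by rewrite divr_ge0.
have := sinh_ge h0; rewrite e1 e2.
move: (expR _) (expR _) e3 => B A AB H.
have {}H : u <= A - B by lra.
have : u ^+ 2 <= (A - B) ^+ 2 by rewrite ler_sqr ?nnegrE//; lra.
rewrite [(A - B) ^+ 2](_ : _ = A ^+ 2 + B ^+ 2 - 2 * (A * B)); last by ring.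
rewrite AB; lra.
Qed.

(** The derivative of v^2/2 - ln (cosh v) is v - tanh v; its numerator G vanishes at 0 and has
    derivative 2 v sinh v. *)
Lemma cosh_le (u : R) : 0 <= u -> cosh u <= expR (u ^+ 2 / 2).
Proof.
move=> u0; rewrite -[leLHS]lnK ?posrE ?cosh_gt0// ler_expR.
have derN1 (v : R) : der (fun w => - w) v (- 1) by apply: derN; exact: derI.
have derch (v : R) : der (fun w => expR w + expR (- w)) v (expR v - expR (- v)).
  apply: der_eq; first by apply: derD; apply: der_expR; [exact: derI|exact: derN1].
  by rewrite /=; ring.
have dersh (v : R) : der (fun w => expR w - expR (- w)) v (expR v + expR (- v)).
  apply: der_eq; first by apply: derB; apply: der_expR; [exact: derI|exact: derN1].
  by rewrite /=; ring.
pose G (v : R) := v * (expR v + expR (- v)) - (expR v - expR (- v)).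
have G0 (w : R) : 0 <= w -> 0 <= G w.
  move=> w0; suff : G 0 <= G w by rewrite {1}/G oppr0 mul0r !subrr.
  apply: (@der_le _ G (fun v => v * (expR v - expR (- v)))) => [//|v _|v /andP[v0 _]].
    apply: der_eq; first by apply: derB; [apply: derM; [exact: derI|exact: derch]|exact: dersh].
    by rewrite /=; ring.
  by rewrite mulr_ge0// subr_ge0 ler_expR; lra.
pose F (v : R) := v * v / 2 - ln (cosh v).
suff : F 0 <= F u.
  by rewrite /F !mul0r /cosh oppr0 expR0 (_ : (1 + 1) / 2 = 1) ?ln1 ?subrr ?subr_ge0 ?expr2//; field.
apply: (@der_le _ F (fun v => G v / (2 * cosh v))) => [//|v _|v /andP[v0 _]].
  apply: der_eq.
    apply: derB.
      by apply: derM; [apply: derM; exact: derI|exact: derC].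
    by apply: der_ln; [exact: cosh_gt0|apply: derM; [exact: derch|exact: derC]].
  rewrite /G /cosh /=.
  have : expR v + expR (- v) != 0 by rewrite gt_eqF// addr_gt0 ?expR_gt0.
  by move: (expR v) (expR (- v)) => A B AB; field.
by rewrite divr_ge0 ?G0// mulr_ge0// ltW// cosh_gt0.
Qed.

(** * Lower bounds for binomial coefficients *)

Lemma expR_frac_le (u : R) : 0 <= u -> expR (u / (1 + u)) <= 1 + u.
Proof.
move=> u0; have u1 : 0 < 1 + u by rewrite ltr_pwDl.
have := expR_ge1Dx (- (u / (1 + u))).
rewrite expRN (_ : 1 + - (u / (1 + u)) = (1 + u)^-1); last first.
  by field; rewrite gt_eqF.
by rewrite lef_pV2 ?posrE ?expR_gt0.
Qed.

(** A weak Stirling bound, N! <= e N (N/e)^N for N = d + 1. The induction step is e <= (1 + 1/N)^(N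
    + 1). *)
Lemma fact_le (d : nat) : (d.+1)`!%:R * expR d%:R <= d.+1%:R ^+ d.+2 :> R.
Proof.
elim: d => [|d IH]; first by rewrite (_ : 1`! = 1%N)// expR0 mulr1 expr1n.
rewrite factS natrM -[X in expR X]natr1 expRD [expR _ * expR 1]mulrC.
have d0 : 0 <= d.+2%:R * expR 1 :> R by rewrite mulr_ge0 ?expR_ge0.
have := ler_wpM2l d0 IH; rewrite mulrACA => H.
apply: le_trans H _.
rewrite exprS -mulrA ler_wpM2l//.
have d1 : 0 < d.+1%:R :> R by rewrite ltr0n.
have d2 : 0 < d.+2%:R :> R by rewrite ltr0n.
have u0 : 0 <= d.+1%:R^-1 :> R by rewrite invr_ge0.
have := expR_frac_le u0.
rewrite (_ : _ / _ = d.+2%:R^-1); last first.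
  rewrite -[d.+2%:R]natr1; move: (d.+1%:R) d1 => N N0.
  by field; rewrite !gt_eqF// ?addr_gt0.
move=> H1; have : expR 1 <= (1 + d.+1%:R^-1) ^+ d.+2 :> R.
  rewrite (_ : 1 = d.+2%:R * d.+2%:R^-1); last by rewrite divff// gt_eqF.
  by rewrite expRM_natl lerXn2r ?nnegrE ?expR_ge0// divff ?gt_eqF// addr_ge0.
have p0 : 0 <= d.+1%:R ^+ d.+2 :> R by rewrite exprn_ge0.
move/(ler_wpM2r p0)/le_trans; apply.
rewrite -exprMn mulrDl mulVf ?gt_eqF// mul1r natr1//.
Qed.

(** Each of the d + 1 factors of the falling factorial of (m + 1)(d + 1) is at least m (d + 1);
    [fact_le] bounds the denominator. *)
Lemma binomial_ge (m d : nat) :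
  (m%:R ^+ d.+1 * expR d%:R <= 'C(m.+1 * d.+1, d.+1)%:R * d.+1%:R :> R).
Proof.
have f0 : 0 < (d.+1)`!%:R :> R by rewrite ltr0n fact_gt0.
have d0 : 0 < d.+1%:R ^+ d.+1 :> R by rewrite exprn_gt0.
have h1 : (m%:R * d.+1%:R) ^+ d.+1 <= 'C(m.+1 * d.+1, d.+1)%:R * (d.+1)`!%:R :> R.
  rewrite -!natrM -natrX ler_nat bin_ffact.
  have : forall k N M, (M <= N - k -> M ^ k <= N ^_ k)%N.
    elim=> [//|k IH] N M h; rewrite ffactnSr expnSr leq_mul//.
      by apply: IH; apply: leq_trans h _; rewrite leq_sub2l.
    by apply: leq_trans h _; rewrite leq_sub2l.
  by apply; rewrite mulSn addKn.
rewrite -(ler_pM2l d0) mulrA -exprMn [d.+1%:R * _]mulrC.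
apply: le_trans (ler_wpM2r (expR_ge0 _) h1) _.
have := ler_wpM2l (ler0n R 'C(m.+1 * d.+1, d.+1)) (fact_le d).
rewrite mulrA => /le_trans; apply. by rewrite [leRHS]mulrCA [in leLHS]exprSr.
Qed.

(** * Elementary symmetric polynomials *)

Definition elem_sym d n (x : cube n) : R :=
  \sum_(t : d.-tuple 'I_n | sorted ltn (map val t)) \prod_(k < d) sgb (x (tnth t k)).

Definition elem_symC d n (x : cube n) : R[i] := (elem_sym d x)%:C%C.

Lemma elem_sym_homogeneous d n : homogeneous d (@elem_symC d n).
Proof.
exists (fun=> 1) => x; rewrite /elem_symC rmorph_sum; apply: eq_bigr => t _.
rewrite mul1r rmorph_prod; apply: eq_bigr => k _.
by rewrite /Defs.coord /sgb; case: (x _); rewrite ?rmorphN rmorph1 ?expr1 ?expr0.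
Qed.

Lemma avg_sum (T I : finType) (P : pred I) (F : I -> T -> R) :
  avg (fun x => \sum_(i | P i) F i x) = \sum_(i | P i) avg (F i).
Proof.
by rewrite avg.unlock exchange_big big_distrl.
Qed.

Lemma avg_cube_prod n (H : 'I_n -> bool -> R) :
  avg (fun x : cube n => \prod_i H i (x i)) = \prod_i avg (H i).
Proof.
rewrite avg.unlock sum_cube_prod card_cube natrX -[X in _ / _ ^+ X]card_ord.
rewrite -prodr_const -prodf_div; apply: eq_bigr => i _.
by rewrite card_bool.
Qed.

Lemma sorted_tuple_eq d n (t u : d.-tuple 'I_n) :
  sorted ltn (map val t) -> sorted ltn (map val u) -> t =i u -> t = u.
Proof.
move=> st su tu; apply/val_inj/(inj_map val_inj).
apply: (irr_sorted_eq ltn_trans ltnn st su) => i.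
by apply/mapP/mapP => -[j]; rewrite ?tu -?tu => jt ->; exists j; rewrite ?tu -?tu.
Qed.

(** The monomials are orthonormal, and there is one for each d-subset of the coordinates. *)
Lemma avg_elem_sym_sqr d n :
  avg (fun x : cube n => elem_sym d x ^+ 2) = 'C(n, d)%:R.
Proof.
have h (t u : d.-tuple 'I_n) : sorted ltn (map val t) -> sorted ltn (map val u) ->
    avg (fun x : cube n => (\prod_(k < d) sgb (x (tnth t k))) * \prod_(k < d) sgb (x (tnth u k)))
    = (t == u)%:R :> R.
  move=> st su.
  pose H (i : 'I_n) (b : bool) := (if i \in t then sgb b else 1) * (if i \in u then sgb b else 1) : R.
  rewrite (eq_avg (g := fun x : cube n => \prod_i H i (x i))); last first.
    move=> x; rewrite (prod_sorted_tuple (fun i => sgb (x i)) st).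
    by rewrite (prod_sorted_tuple (fun i => sgb (x i)) su) -big_split.
  rewrite avg_cube_prod; have [tu|tu] := eqVneq t u.
    rewrite big1// => i _; rewrite avg_bool /H /sgb tu.
    by case: (i \in u); field.
  have [/forallP e|] := boolP [forall i, (i \in t) == (i \in u)].
    case/eqP: tu; apply: sorted_tuple_eq => // i; exact/eqP.
  (* A coordinate lying in exactly one of the two tuples contributes a factor of mean 0. *)
  rewrite negb_forall => /existsP[i iP]; rewrite (bigD1 i)//= avg_bool /H /sgb.
  by move: iP; case: (i \in t); case: (i \in u) => // _; rewrite ?mulr1 ?mul1r addNr !mul0r.
rewrite (eq_avg (g := fun x : cube n => \sum_(t : d.-tuple 'I_n | sorted ltn (map val t))
    \sum_(u : d.-tuple 'I_n | sorted ltn (map val u))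
     (\prod_(k < d) sgb (x (tnth t k))) * \prod_(k < d) sgb (x (tnth u k)))); last first.
  by move=> x; rewrite expr2 big_distrlr.
rewrite avg_sum -card_ltn_sorted_tuples -sum1_card natr_sum.
apply: eq_big => [t|t st]; first by rewrite inE.
rewrite avg_sum (bigD1 t)//= h// eqxx big1 ?addr0// => u /andP[su ut].
by rewrite h// eq_sym (negbTE ut).
Qed.

Lemma cube_norm2_elem_sym d n :
  cube_norm 2 (@elem_symC d n) ^+ 2 = 'C(n, d)%:R.
Proof.
rewrite cube_norm_nrm -powR_mulrn ?nrm_ge0// nrm_powR//.
rewrite -avg_elem_sym_sqr; apply: eq_avg => x.
by rewrite normc_real powR_mulrn// real_normK ?num_real.
Qed.

(** * Duality with an exponential test function *)

Definition expo_test (t : R) n (x : cube n) : R := \prod_i expR (t * sgb (x i)).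

(** By independence each monomial contributes sinh t for each of its d indices and cosh t for each
    other index. *)
Lemma avg_elem_sym_expo t d n :
  avg (fun x : cube n => elem_sym d x * expo_test t x) =
  'C(n, d)%:R * (cosh t ^+ n * ((expR t - expR (- t)) / 2 / cosh t) ^+ d).
Proof.
set w := (expR t - expR (- t)) / 2.
rewrite (eq_avg (g := fun x : cube n => \sum_(u : d.-tuple 'I_n | sorted ltn (map val u))
    \prod_i ((if i \in u then sgb (x i) else 1) * expR (t * sgb (x i))))); last first.
  move=> x; rewrite /elem_sym big_distrl /=; apply: eq_bigr => u su.
  by rewrite (prod_sorted_tuple (fun i => sgb (x i)) su) -big_split.
rewrite avg_sum -card_ltn_sorted_tuples -sum1_card natr_sum big_distrl /=.
apply: eq_big => [u|u su]; first by rewrite inE.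
rewrite (avg_cube_prod (fun i b => (if i \in u then sgb b else 1) * expR (t * sgb b))).
rewrite (eq_bigr (fun i => cosh t * (if i \in u then w / cosh t else 1))); last first.
  move=> i _; rewrite avg_bool /sgb mulrN1 mulr1 /w.
  case: ifP => _; last by rewrite !mul1r mulr1 /cosh addrC.
  by rewrite mulrCA divff ?gt_eqF ?cosh_gt0// mulr1 mulN1r mul1r addrC.
rewrite big_split /= prodr_const card_ord mul1r; congr (_ * _).
by rewrite -prod_sorted_tuple// prodr_const card_ord.
Qed.

Lemma nrm_expo_test_le (t p : R) n : 0 < p -> 0 <= t ->
  nrm p (@expo_test t n) <= expR (p * t ^+ 2 / 2 * n%:R).
Proof.
move=> p0 t0; rewrite nrm_def.
rewrite (eq_avg (g := fun x : cube n => \prod_i expR (p * t * sgb (x i)))); last first.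
  move=> x; rewrite /expo_test.
  rewrite -expR_sum -expRM -[_ * p]mulrC mulr_sumr expR_sum.
  by apply: eq_bigr => i _; rewrite mulrA.
rewrite (avg_cube_prod (fun i b => expR (p * t * sgb b))).
rewrite (eq_bigr (fun=> cosh (p * t))); last first.
  by move=> i _; rewrite avg_bool /sgb /cosh mulrN1 mulr1 addrC.
rewrite prodr_const card_ord.
have pt : 0 <= p * t by rewrite mulr_ge0 ?(ltW p0).
have -> : expR (p * t ^+ 2 / 2 * n%:R) = (expR ((p * t) ^+ 2 / 2) ^+ n) `^ p^-1.
  by rewrite -expRM_natr -expRM; congr expR; field; rewrite gt_eqF.
have p1 : 0 <= p^-1 by rewrite invr_ge0 ltW.
rewrite ge0_ler_powR ?nnegrE ?exprn_ge0 ?expR_ge0 ?(ltW (cosh_gt0 _))//.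
by rewrite lerXn2r ?nnegrE ?expR_ge0 ?(ltW (cosh_gt0 _))// cosh_le.
Qed.

Lemma elem_sym_dual_bound (q t : R) d n : 1 < q -> 0 <= t ->
  'C(n, d)%:R * (cosh t ^+ n * ((expR t - expR (- t)) / 2 / cosh t) ^+ d) <=
  cube_norm q (@elem_symC d n) *
    expR (q / (q - 1) * t ^+ 2 / 2 * n%:R).
Proof.
move=> q1 t0; have q0 : 0 < q by lra.
have q10 : 0 < q - 1 by lra.
have q'0 : 0 < q / (q - 1) by rewrite divr_gt0.
rewrite -avg_elem_sym_expo cube_norm_nrm.
apply: le_trans (ler_wpM2l (nrm_ge0 _ _) (nrm_expo_test_le _ q'0 t0)).
have g0 (x : cube n) : 0 <= expo_test t x.
  by apply: prodr_ge0 => i _; exact: expR_ge0.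
apply: le_trans (hoelder_avg q0 q'0 _ (fun x => normc_ge0 _) g0).
  by apply: ler_avg => x; rewrite normc_real ler_wpM2r// ler_norm.
by field; rewrite !gt_eqF.
Qed.

(** The dual bound gives N y^(d+1) <= ||h||_q, where N = ||h||_2^2. After squaring, one factor N is
    bounded below by [binomial_ge] at the cost of e (d + 1). The hypothesis on C absorbs the errors
    of order 1/M, where M = m + 1. *)
Lemma elem_sym_ratio (q C : R) (m d : nat) : 1 < q -> 0 <= C ->
  C <= (q - 1) * (1 - (1 + (q ^+ 2 - 1) / 2) / m.+1%:R) ->
  cube_norm 2 (@elem_symC d.+1 (m.+1 * d.+1)) ^+ 2 * C ^+ d.+1 <=
  cube_norm q (@elem_symC d.+1 (m.+1 * d.+1)) ^+ 2 * (expR 1 * d.+1%:R).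
Proof.
move=> q1 C0 HC.
have q10 : 0 < q - 1 by lra.
have m0 : 0 < m.+1%:R :> R by rewrite ltr0n.
have d0 : 0 < d.+1%:R :> R by rewrite ltr0n.
(* This t turns the exponential in the dual bound into exp (q/2)^(d+1), free of M. *)
pose t := Num.sqrt ((q - 1) / m.+1%:R); pose u := t ^+ 2 / 2.
have t0 : 0 <= t by exact: sqrtr_ge0.
have t2 : t ^+ 2 = (q - 1) / m.+1%:R by rewrite sqr_sqrtr// divr_ge0 ?ltW.
have u0 : 0 <= u by rewrite divr_ge0// sqr_ge0.
set Nq := cube_norm q _; set N := 'C(m.+1 * d.+1, d.+1)%:R : R.
have Nq0 : 0 <= Nq by rewrite /Nq cube_norm_nrm nrm_ge0.
have N0 : 0 <= N by exact: ler0n.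
have := elem_sym_dual_bound d.+1 (m.+1 * d.+1) q1 t0.
rewrite -/(elem_symC _) -/Nq -/N exprM -exprMn [cosh t ^+ m.+1]exprSr -(mulrA (_ ^+ m)).
rewrite (mulrC (cosh t)) divfK ?gt_eqF ?cosh_gt0//.
set s := (_ - _) / 2.
have -> : q / (q - 1) * t ^+ 2 / 2 * (m.+1 * d.+1)%:R = q / 2 * d.+1%:R.
  by rewrite t2 natrM; field; rewrite !gt_eqF.
rewrite expRM_natr => H.
have ts : t <= s by rewrite /s ler_pdivlMr// mulrC; exact: sinh_ge.
set c := cosh t in H *.
have c1 : 1 + u <= c by exact: cosh_ge.
have s0 : 0 <= s by apply: le_trans ts.
have c0 : 0 <= c by apply: ltW; exact: cosh_gt0.
(* Chosen so that exp a <= 1 + u <= cosh t. *)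
pose a := u / (1 + u).
have H1 : expR (m%:R * a) * t <= c ^+ m * s.
  rewrite expRM_natl; apply: ler_pM => //; rewrite ?exprn_ge0 ?expR_ge0//.
  rewrite lerXn2r ?nnegrE ?expR_ge0//.
  exact: le_trans (expR_frac_le u0) c1.
have H2 : N * (expR (m%:R * a) * t) ^+ d.+1 <= Nq * expR (q / 2) ^+ d.+1.
  have P1 : 0 <= expR (m%:R * a) * t by rewrite mulr_ge0// expR_ge0.
  have P2 : 0 <= c ^+ m * s by rewrite mulr_ge0// exprn_ge0.
  by apply: le_trans H; rewrite ler_wpM2l// lerXn2r.
pose y := expR (m%:R * a - q / 2) * t.
have y0 : 0 <= y by rewrite mulr_ge0 ?expR_ge0.
have H3 : N * y ^+ d.+1 <= Nq.
  have -> : y = expR (m%:R * a) * t / expR (q / 2) by rewrite /y expRB mulrAC.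
  by rewrite expr_div_n mulrA ler_pdivrMr ?exprn_gt0 ?expR_gt0.
have H4 : N ^+ 2 * (y ^+ 2) ^+ d.+1 <= Nq ^+ 2.
  rewrite exprAC -exprMn ler_sqr ?nnegrE// mulr_ge0// exprn_ge0//.
(* It suffices that C <= m e y^2, since [binomial_ge] bounds (m e)^(d+1) by N e (d + 1). *)
have H5 : C ^+ d.+1 * N <= N ^+ 2 * (y ^+ 2) ^+ d.+1 * (expR 1 * d.+1%:R).
  have K : C <= m%:R * expR 1 * y ^+ 2.
    apply: le_trans HC _.
    (* W = M (1 + u), because M u = (q - 1)/2. *)
    pose W := m.+1%:R + (q - 1) / 2.
    have W0 : 0 < W by rewrite addr_gt0 ?divr_gt0.
    have ea : m%:R * a = (q - 1) / 2 * m%:R / W.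
      rewrite /a /u t2 /W; field.
      by apply/andP; split; apply: lt0r_neq0; have := ler0n R m; lra.
    have -> : m%:R * expR 1 * y ^+ 2 =
       (q - 1) * (m%:R / m.+1%:R * expR ((q - 1) * (m%:R / W - 1))).
      rewrite /y exprMn t2 -expRM_natl ea.
      rewrite (_ : (q - 1) * (m%:R / W - 1) = 1 + 2 * ((q - 1) / 2 * m%:R / W - q / 2)); last first.
        by field; rewrite gt_eqF.
      by rewrite expRD; ring.
    rewrite ler_wpM2l ?(ltW q10)//.
    set b := (q ^+ 2 - 1) / 2 / m.+1%:R.
    have b0 : 0 <= b by rewrite !divr_ge0// subr_ge0 exprn_ege1// ltW.
    have E1 : 1 - b <= expR ((q - 1) * (m%:R / W - 1)).
      apply: le_trans (expR_ge1Dx _); rewrite lerD2l.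
      rewrite (_ : (q - 1) * (m%:R / W - 1) = - ((q ^+ 2 - 1) / 2 / W)); last first.
        by rewrite /W; field; apply: lt0r_neq0; have := ler0n R m; lra.
      rewrite lerN2 ler_wpM2l//; first by rewrite divr_ge0// subr_ge0 exprn_ege1// ltW.
      by rewrite lef_pV2 ?posrE// lerDl divr_ge0// ltW.
    have e1 : m%:R / m.+1%:R = 1 - m.+1%:R^-1 :> R.
      by rewrite -{1}[m%:R](addrK 1) natr1 mulrBl divff ?gt_eqF// mul1r.
    have M0 : 0 <= m%:R / m.+1%:R :> R by rewrite divr_ge0.
    (* What remains is (1 - 1/M) (1 - b) >= 1 - 1/M - b. *)
    apply: le_trans (ler_wpM2l M0 E1); rewrite e1.
    have mi : 0 <= m.+1%:R^-1 :> R by rewrite invr_ge0.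
    have := mulr_ge0 mi b0.
    rewrite (_ : (1 + (q ^+ 2 - 1) / 2) / m.+1%:R = m.+1%:R^-1 + b); last by rewrite /b mulrDl mul1r.
    by move: (m.+1%:R^-1) b {mi b0 E1 e1} => i b; lra.
  have K' : C ^+ d.+1 <= m%:R ^+ d.+1 * expR 1 ^+ d.+1 * (y ^+ 2) ^+ d.+1.
    by rewrite -!exprMn lerXn2r ?nnegrE// (le_trans C0).
  have Y0 : 0 <= (y ^+ 2) ^+ d.+1 by rewrite exprn_ge0// sqr_ge0.
  have B := binomial_ge m d; rewrite -/N in B.
  have {}B : m%:R ^+ d.+1 * expR 1 ^+ d.+1 <= N * d.+1%:R * expR 1.
    rewrite [expR 1 ^+ _]exprSr mulrA ler_wpM2r ?expR_ge0//.
    by rewrite -(expRM_natl d 1) mulr1.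
  have := le_trans K' (ler_wpM2r Y0 B).
  move/(ler_wpM2r N0)/le_trans; apply.
  rewrite le_eqVlt; apply/orP; left; apply/eqP.
  by move: (_ ^+ d.+1) (expR 1) (d.+1%:R) => Y e D; ring.
rewrite [cube_norm 2 _ ^+ 2]cube_norm2_elem_sym mulrC.
apply: le_trans H5 _.
by rewrite ler_wpM2r// mulr_ge0 ?expR_ge0.
Qed.

(** * Failure of smaller constants *)

Lemma exp_beats_linear (rho : R) (D : nat) : 1 < rho ->
  exists d : nat, (D <= d)%N /\ expR 1 * d.+1%:R < rho ^+ d.+1.
Proof.
move=> r1; have r0 : 0 < rho by lra.
pose l := ln rho; have l0 : 0 < l by rewrite ln_gt0.
(* The quadratic term of exp ((k + 1) l) exceeds e (k + 1) once k l^2 > 2 e; adding D ensures D <=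
   k. *)
pose k := (Num.bound (2 * expR 1 / l ^+ 2) + D)%N.
have hk : 2 * expR 1 < k%:R * l ^+ 2.
  rewrite -ltr_pdivrMr ?exprn_gt0//.
  have b0 : 0 <= 2 * expR 1 / l ^+ 2.
    by apply: divr_ge0; [apply: mulr_ge0 => //; exact: expR_ge0 | exact: sqr_ge0].
  by apply: lt_le_trans (archi_boundP b0) _; rewrite ler_nat leq_addr.
exists k; split; first exact: leq_addl.
have k0 : 0 < k.+1%:R :> R by rewrite ltr0n.
rewrite -[rho]lnK ?posrE// -/l -expRM_natl.
have kl : 0 <= k.+1%:R * l by rewrite mulr_ge0// ltW.
apply: lt_le_trans (expR_ge1Dxn 1 kl).
rewrite (_ : 2`! = 2%N)// exprMn.
have h : 0 < k.+1%:R * (k%:R * l ^+ 2 - 2 * expR 1) by rewrite mulr_gt0// subr_gt0.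
have l2 : 0 <= k.+1%:R * l ^+ 2 by rewrite mulr_ge0// sqr_ge0.
have e : k.+1%:R ^+ 2 * l ^+ 2 = k.+1%:R * (k%:R * l ^+ 2) + k.+1%:R * l ^+ 2 :> R.
  by rewrite -[in LHS]natr1 -[in RHS]natr1; ring.
lra.
Qed.

Lemma lt_of_sqr_bound (a b C C' K : R) d : 0 <= a -> 0 < a ^+ 2 -> 0 <= b ->
  0 < C -> 0 < K -> a ^+ 2 * C' ^+ d <= b ^+ 2 * K -> K < (C' / C) ^+ d ->
  C `^ (d%:R / 2) * a < b.
Proof.
move=> a0 a2 b0 C0 K0 H hK; rewrite powR_half ?(ltW C0)//.
rewrite -(@ltr_pXn2r _ 2)// ?nnegrE ?mulr_ge0 ?exprn_ge0 ?sqrtr_ge0//.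
rewrite exprMn exprAC sqr_sqrtr ?(ltW C0)//.
rewrite -(ltr_pM2r K0); apply: lt_le_trans H.
rewrite mulrAC mulrC ltr_pM2l// mulrC.
by move: hK; rewrite expr_div_n ltr_pdivlMr ?exprn_gt0.
Qed.

Lemma elem_sym_not_bounded (q C : R) (D : nat) : 1 < q -> 0 < C -> C < q - 1 ->
  exists d n : nat, [/\ (D <= d)%N, (d <= n)%N &
    C `^ (d%:R / 2) * cube_norm 2 (@elem_symC d n) < cube_norm q (@elem_symC d n)].
Proof.
move=> q1 C0 Cq; have q10 : 0 < q - 1 by lra.
(* C' lies midway between C and q - 1: first M is taken large enough that C' is admissible in
   [elem_sym_ratio], then d large enough that (C'/C)^(d+1) exceeds e (d + 1). *)
pose C' := (C + (q - 1)) / 2; pose B := 1 + (q ^+ 2 - 1) / 2.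
have CC' : C < C' by rewrite /C'; lra.
pose m := Num.bound (2 * (q - 1) * B / (q - 1 - C)).
have B0 : 0 <= B by rewrite addr_ge0// divr_ge0// subr_ge0 exprn_ege1// ltW.
have qC : 0 < q - 1 - C by lra.
have m0 : 0 < m.+1%:R :> R by rewrite ltr0n.
have hm : C' <= (q - 1) * (1 - B / m.+1%:R).
  have : 2 * (q - 1) * B / (q - 1 - C) < m.+1%:R.
    have b0 : 0 <= 2 * (q - 1) * B / (q - 1 - C).
      by rewrite divr_ge0 ?mulr_ge0 ?(ltW q10) ?(ltW qC).
    by apply: lt_trans (archi_boundP b0) _; rewrite ltr_nat.
  rewrite ltr_pdivrMr// [m.+1%:R * _]mulrC -ltr_pdivrMr// => h.
  have e : 2 * (q - 1) * B / m.+1%:R = 2 * ((q - 1) * (B / m.+1%:R)).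
    by rewrite -!mulrA.
  rewrite e in h; rewrite /C'; move: (B / _) h => x h; lra.
clearbody m.
have r1 : 1 < C' / C by rewrite ltr_pdivlMr// mul1r.
have [d [Dd hd]] := exp_beats_linear D r1.
exists d.+1, (m.+1 * d.+1)%N; split; [exact: leqW|exact: leq_pmull|].
have C'0 : 0 <= C' by lra.
have := elem_sym_ratio d q1 C'0 hm.
set h := @elem_symC d.+1 _.
have N2 : 0 < cube_norm 2 h ^+ 2.
  rewrite cube_norm2_elem_sym ltr0n bin_gt0; exact: leq_pmull.
have Nq : 0 <= cube_norm q h by rewrite cube_norm_nrm nrm_ge0.
have N2' : 0 <= cube_norm 2 h by rewrite cube_norm_nrm nrm_ge0.
have D0 : 0 < expR 1 * d.+1%:R :> R by rewrite mulr_gt0 ?expR_gt0.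
by move=> H; exact: (lt_of_sqr_bound N2' N2 Nq C0 D0 H hd).
Qed.

(** A bound with C from p to q, composed with the one from 2 to p, would give the constant C A < q -
    1 from 2 to q, which the elementary symmetric polynomials exclude. *)
Lemma sharp_of_l2_bound (p q A : R) : 1 < q -> 0 < A ->
  (forall (d n : nat) (h : cube n -> R[i]), homogeneous d h ->
    cube_norm p h <= A `^ (d%:R / 2) * cube_norm 2 h) ->
  asymptotically_sharp p q ((q - 1) / A).
Proof.
move=> q1 A0 hA C C0 CA [D hD].
have CA0 : 0 < C * A by rewrite mulr_gt0.
have CAq : C * A < q - 1 by rewrite -ltr_pdivlMr.
have [d [n [Dd dn]]] := elem_sym_not_bounded D q1 CA0 CAq.
rewrite ltNge => /negP; apply.
have hh := @elem_sym_homogeneous d n.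
apply: le_trans (hD d Dd n dn _ hh) _.
rewrite powRM; [|exact: ltW|exact: ltW].
by rewrite -mulrA; apply: ler_wpM2l; [exact: powR_ge0|exact: hA].
Qed.

End Sharpness.

Theorem theorem2 (R : realType) (p q : R) (hp : 1 <= p) (hpq : p <= q) :
  (forall (d n : nat), (1 <= d)%N -> (d <= n)%N ->
     forall h : cube n -> R[i], homogeneous d h ->
       cube_norm q h <= chaos_const p q d * cube_norm p h) /\
  (p <= 2 -> 2 <= q -> p^-1 + q^-1 <= 1 ->
     asymptotically_sharp p q (q - 1)) /\
  (2 < p -> asymptotically_sharp p q ((q - 1) / (p - 1))).
Proof.
split; [|split].
- by move=> d n _ _ h; apply: homogeneous_chaos_const.
(* For p <= 2 norms are monotone, so A = 1. *)
- move=> p2 q2 _; rewrite -[q - 1]divr1.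
  apply: sharp_of_l2_bound => //; first by lra.
  move=> d n h _; rewrite powR1 mul1r !cube_norm_nrm nrm_mono//; first by lra.
  by move=> x; exact: normc_ge0.
(* For p > 2 Bonami's bound from 2 to p gives A = p - 1. *)
- move=> p2; apply: sharp_of_l2_bound; [lra|lra|].
  move=> d n h hh; have := @homogeneous_bonami _ 2 p d n h _ (ltW p2) hh.
  rewrite (_ : 2 - 1 = 1) ?divr1; last by ring.
  by apply; lra.
Qed.
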